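(* Let $(M,\xi,\lambda,g)$ be a compact and connected $n$-dimensional gradient almost Ricci soliton ($n>2$) whose potential vector field $\xi$ is affine conformal Killing, i.e. $$\mathcal L_{\xi}\nabla=d\rho\otimes I+I\otimes d\rho-g\otimes\nabla\rho$$ for a smooth function $\rho$ on $M$. If $$\operatorname{Ric}(\xi,\xi)\geq -n\,\xi(\lambda),$$ then $\xi$ is an affine Killing vector field and the manifold is a trivial Ricci soliton.
   Context: $(M,g)$ is a Riemannian manifold with Levi-Civita connection $\nabla$; $\nabla\rho$ is the gradient of $\rho$. The displayed condition on $\xi$ means $(\mathcal L_{\xi}\nabla)(X,Y)=X(\rho)Y+Y(\rho)X-g(X,Y)\nabla\rho$ for all vector fields $X,Y$. $(M,\xi,\lambda,g)$ is an almost Ricci soliton if $\lambda$ is a smooth function on $M$ and $\frac12\mathcal L_{\xi}g+\operatorname{Ric}=\lambda g$; it is gradient if $\xi=\nabla f$ for a smooth function $f$ on $M$; it is a Ricci soliton if $\lambda$ is constant, and it is trivial if its potential vector field $\xi$ is Killing, i.e. $\mathcal L_\xi g=0$. A vector field $\xi$ is affine Killing if $\mathcal L_\xi\nabla=0$. *)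

(* Defs.v *)
(* Differential geometry of a smooth n-manifold over a realType, in the
   classical language of charts.  A tensorial object on M (vector field, metric,
   connection) is the family of its local representatives, one for each chart
   of the atlas, subject to the usual change-of-chart law.  The differential
   operators (Lie bracket, covariant derivative, curvature, Lie derivatives)
   are given by their coordinate-free formulas, applied to the representatives
   in one chart; values outside the codomain of the chart are irrelevant. *)
From HB Require Import structures.
From mathcomp Require Import all_boot all_order all_algebra.
From mathcomp Require Import all_classical all_reals all_analysis.

Set Implicit Arguments.
Unset Strict Implicit.
Unset Printing Implicit Defensive.

Import Order.TTheory GRing.Theory Num.Theory numFieldNormedType.Exports.
Local Open Scope classical_set_scope.
Local Open Scope ring_scope.

(* C^k on U; meaningful for open U, since 'D_v f x depends on the germ of f *)
Fixpoint class_C (R : realType) (n : nat) (W : normedModType R) (k : nat)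
    (U : set 'rV[R]_n) (f : 'rV[R]_n -> W) : Prop :=
  match k with
  | 0 => forall x, U x -> {for x, continuous f}
  | k'.+1 => (forall x, U x -> differentiable f x) /\
             (forall v, class_C k' U ('D_v f))
  end.

Definition smooth_on (R : realType) (n : nat) (W : normedModType R)
    (U : set 'rV[R]_n) (f : 'rV[R]_n -> W) : Prop :=
  forall k, class_C k U f.

(* a homeomorphism from the open set dom of T onto the open set cod of R^n,
   both maps being extended arbitrarily to total functions *)
Record chart (R : realType) (n : nat) (T : topologicalType) := Chart {
  dom : set T;
  cod : set 'rV[R]_n;
  coords : T -> 'rV[R]_n;
  param : 'rV[R]_n -> T;
  dom_open : open dom;
  cod_open : open cod;
  coords_cod : forall p, dom p -> cod (coords p);
  param_dom : forall x, cod x -> dom (param x);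
  coordsK : forall p, dom p -> param (coords p) = p;
  paramK : forall x, cod x -> coords (param x) = x;
  coords_continuous : forall p, dom p -> {for p, continuous coords};
  param_continuous : forall x, cod x -> {for x, continuous param}
}.

Definition overlap (R : realType) (n : nat) (T : topologicalType)
    (c d : chart R n T) : set 'rV[R]_n :=
  [set x | cod c x /\ dom d (param c x)].

Definition transition (R : realType) (n : nat) (T : topologicalType)
    (c d : chart R n T) : 'rV[R]_n -> 'rV[R]_n :=
  coords d \o param c.

(* the smooth structure is given by an indexed, not necessarily maximal, atlas *)
Record manifold (R : realType) (n : nat) := Manifold {
  carrier :> topologicalType;
  carrier_hausdorff : hausdorff_space carrier;
  carrier_second_countable : @second_countable carrier;
  chart_index : Type;
  atlas : chart_index -> chart R n carrier;
  atlas_cover : forall p : carrier, exists i, dom (atlas i) p;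
  atlas_smooth : forall i j,
    smooth_on (overlap (atlas i) (atlas j)) (transition (atlas i) (atlas j))
}.

Definition local_rep (R : realType) (n : nat) (M : manifold R n) (h : M -> R)
    (i : chart_index M) : 'rV[R]_n -> R := h \o param (atlas i).

Definition smooth_function (R : realType) (n : nat) (M : manifold R n)
    (h : M -> R) : Prop :=
  forall i, smooth_on (cod (atlas i)) (local_rep h i).

(* the components in two charts are related by the Jacobian of the transition *)
Definition is_vector_field (R : realType) (n : nat) (M : manifold R n)
    (X : chart_index M -> 'rV[R]_n -> 'rV[R]_n) : Prop :=
  (forall i, smooth_on (cod (atlas i)) (X i)) /\
  (forall i j x, overlap (atlas i) (atlas j) x ->
    X j (transition (atlas i) (atlas j) x)
      = 'D_(X i x) (transition (atlas i) (atlas j)) x).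

Record vector_field (R : realType) (n : nat) (M : manifold R n) := VectorField {
  components :> chart_index M -> 'rV[R]_n -> 'rV[R]_n;
  components_field : is_vector_field components
}.

Definition bilin (R : realType) (n : nat) (A : 'M[R]_n) (u v : 'rV[R]_n) : R :=
  (u *m A *m v^T) ord0 ord0.

Record metric (R : realType) (n : nat) (M : manifold R n) := Metric {
  gram :> chart_index M -> 'rV[R]_n -> 'M[R]_n;
  gram_smooth : forall i, smooth_on (cod (atlas i)) (gram i);
  gram_sym : forall i x, cod (atlas i) x -> (gram i x)^T = gram i x;
  gram_pos : forall i x u, cod (atlas i) x -> u != 0 -> 0 < bilin (gram i x) u u;
  gram_transition : forall i j x u v, overlap (atlas i) (atlas j) x ->
    bilin (gram i x) u v
      = bilin (gram j (transition (atlas i) (atlas j) x))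
              ('D_u (transition (atlas i) (atlas j)) x)
              ('D_v (transition (atlas i) (atlas j)) x)
}.

Definition bracket (R : realType) (n : nat) (X Y : 'rV[R]_n -> 'rV[R]_n)
    : 'rV[R]_n -> 'rV[R]_n :=
  fun x => 'D_(X x) Y x - 'D_(Y x) X x.

(* (Gamma k x) a b is the connection coefficient Gamma^k_ab, i.e. the k-th
   component of nabla_(d_a) d_b, so that
   (nabla_X Y)^k = X(Y^k) + Gamma^k_ab X^a Y^b *)
Definition cov (R : realType) (n : nat) (Gamma : 'I_n -> 'rV[R]_n -> 'M[R]_n)
    (X Y : 'rV[R]_n -> 'rV[R]_n) : 'rV[R]_n -> 'rV[R]_n :=
  fun x => 'D_(X x) Y x + \row_k bilin (Gamma k x) (X x) (Y x).

(* cov_field imposes both the smoothness of the coefficients and their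
   (non-tensorial) change-of-chart law *)
Record connection (R : realType) (n : nat) (M : manifold R n) := Connection {
  coef :> chart_index M -> 'I_n -> 'rV[R]_n -> 'M[R]_n;
  cov_field : forall X Y : vector_field M,
    is_vector_field (fun i => cov (coef i) (X i) (Y i))
}.

Definition levi_civita (R : realType) (n : nat) (M : manifold R n)
    (g : metric M) (nabla : connection M) : Prop :=
  (forall (X Y : vector_field M) (i : chart_index M) (x : 'rV[R]_n),
    cod (atlas i) x ->
    cov (nabla i) (X i) (Y i) x - cov (nabla i) (Y i) (X i) x
      = bracket (X i) (Y i) x) /\
  (forall (X Y Z : vector_field M) (i : chart_index M) (x : 'rV[R]_n),
    cod (atlas i) x ->
    'D_(X i x) (fun y => bilin (g i y) (Y i y) (Z i y)) x
      = bilin (g i x) (cov (nabla i) (X i) (Y i) x) (Z i x)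
        + bilin (g i x) (Y i x) (cov (nabla i) (X i) (Z i) x)).

(* R(X,Y)Z = nabla_X nabla_Y Z - nabla_Y nabla_X Z - nabla_[X,Y] Z *)
Definition curvature (R : realType) (n : nat)
    (Gamma : 'I_n -> 'rV[R]_n -> 'M[R]_n) (X Y Z : 'rV[R]_n -> 'rV[R]_n)
    : 'rV[R]_n -> 'rV[R]_n :=
  fun x => cov Gamma X (cov Gamma Y Z) x - cov Gamma Y (cov Gamma X Z) x
           - cov Gamma (bracket X Y) Z x.

(* Ric(Y,Z) = tr (V |-> R(V,Y)Z), the trace being taken in the coordinate
   frame of the chart; Ric is positive on round spheres *)
Definition ricci (R : realType) (n : nat)
    (Gamma : 'I_n -> 'rV[R]_n -> 'M[R]_n) (Y Z : 'rV[R]_n -> 'rV[R]_n)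
    : 'rV[R]_n -> R :=
  fun x => \sum_(k < n)
    (curvature Gamma (fun=> delta_mx ord0 k) Y Z x) ord0 k.

(* (grad h)^k = g^kl d_l h, i.e. g(grad h, v) = dh(v) *)
Definition grad (R : realType) (n : nat) (G : 'rV[R]_n -> 'M[R]_n)
    (h : 'rV[R]_n -> R) : 'rV[R]_n -> 'rV[R]_n :=
  fun x => (\row_l 'D_(delta_mx ord0 l) h x) *m invmx (G x).

Definition lie_metric (R : realType) (n : nat) (G : 'rV[R]_n -> 'M[R]_n)
    (V X Y : 'rV[R]_n -> 'rV[R]_n) : 'rV[R]_n -> R :=
  fun x => 'D_(V x) (fun y => bilin (G y) (X y) (Y y)) x
           - bilin (G x) (bracket V X x) (Y x)
           - bilin (G x) (X x) (bracket V Y x).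

Definition lie_connection (R : realType) (n : nat)
    (Gamma : 'I_n -> 'rV[R]_n -> 'M[R]_n) (V X Y : 'rV[R]_n -> 'rV[R]_n)
    : 'rV[R]_n -> 'rV[R]_n :=
  fun x => bracket V (cov Gamma X Y) x - cov Gamma (bracket V X) Y x
           - cov Gamma X (bracket V Y) x.

Definition killing (R : realType) (n : nat) (M : manifold R n)
    (g : metric M) (xi : vector_field M) : Prop :=
  forall (X Y : vector_field M) (i : chart_index M) (x : 'rV[R]_n),
    cod (atlas i) x -> lie_metric (g i) (xi i) (X i) (Y i) x = 0.

Definition affine_killing (R : realType) (n : nat) (M : manifold R n)
    (nabla : connection M) (xi : vector_field M) : Prop :=
  forall (X Y : vector_field M) (i : chart_index M) (x : 'rV[R]_n),
    cod (atlas i) x -> lie_connection (nabla i) (xi i) (X i) (Y i) x = 0.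

Definition affine_conformal_killing (R : realType) (n : nat) (M : manifold R n)
    (g : metric M) (nabla : connection M) (xi : vector_field M) : Prop :=
  exists2 rho : M -> R, smooth_function rho &
  forall (X Y : vector_field M) (i : chart_index M) (x : 'rV[R]_n),
    cod (atlas i) x ->
    lie_connection (nabla i) (xi i) (X i) (Y i) x
      = 'D_(X i x) (local_rep rho i) x *: Y i x
        + 'D_(Y i x) (local_rep rho i) x *: X i x
        - bilin (g i x) (X i x) (Y i x) *: grad (g i) (local_rep rho i) x.

Definition almost_ricci_soliton (R : realType) (n : nat) (M : manifold R n)
    (g : metric M) (nabla : connection M) (xi : vector_field M)
    (lambda : M -> R) : Prop :=
  smooth_function lambda /\
  forall (X Y : vector_field M) (i : chart_index M) (x : 'rV[R]_n),
    cod (atlas i) x ->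
    2^-1 * lie_metric (g i) (xi i) (X i) (Y i) x
      + ricci (nabla i) (X i) (Y i) x
      = local_rep lambda i x * bilin (g i x) (X i x) (Y i x).

Definition gradient_field (R : realType) (n : nat) (M : manifold R n)
    (g : metric M) (xi : vector_field M) : Prop :=
  exists2 f : M -> R, smooth_function f &
  forall (i : chart_index M) (x : 'rV[R]_n),
    cod (atlas i) x -> xi i x = grad (g i) (local_rep f i) x.

Definition ricci_soliton (R : realType) (n : nat) (M : manifold R n)
    (g : metric M) (nabla : connection M) (xi : vector_field M)
    (lambda : M -> R) : Prop :=
  almost_ricci_soliton g nabla xi lambda /\
  exists a : R, forall p : M, lambda p = a.

Definition trivial_ricci_soliton (R : realType) (n : nat) (M : manifold R n)
    (g : metric M) (nabla : connection M) (xi : vector_field M)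
    (lambda : M -> R) : Prop :=
  ricci_soliton g nabla xi lambda /\ killing g xi.

(* Main.v *)
Require Import Defs.
From HB Require Import structures.
From mathcomp Require Import all_boot all_order all_algebra.
From mathcomp Require Import all_classical all_reals all_analysis.
From mathcomp Require Import ring lra.

Set Implicit Arguments.
Unset Strict Implicit.
Unset Printing Implicit Defensive.

Import Order.TTheory GRing.Theory Num.Theory numFieldNormedType.Exports.
Local Open Scope classical_set_scope.
Local Open Scope ring_scope.

(** Write H for the Hessian of the potential f of xi = grad f, so that
    L_xi g = 2 H. The argument is local tensor calculus followed by a maximum
    principle on the compact manifold.

    Lowering an index, (L_xi nabla)(X, Y) is the second covariant derivative of
    xi plus the curvature term R(xi, X) Y. The first is the derivative of H, which
    is symmetric in its two slots, the second is skew, so the prescribed form of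
    L_xi nabla forces nabla_X H = X(rho) g ([cov_nabla_xi]). The Ricci identity
    then gives R(X, Y) xi = X(rho) Y - Y(rho) X ([Riem_xi]) and, by contraction,
    Ric(xi, .) = (1 - n) d rho. On the other hand Ric = lambda g - H has covariant
    derivative d(lambda - rho) g, and the contracted second Bianchi identity
    yields d lambda = d rho because n > 2 ([schur], [differential_lam_rho]). The
    hypothesis on Ric(xi, xi) therefore becomes xi(rho) >= 0.

    Put w = |xi|^2 = xi(f). From nabla H = d rho g one computes
    xi(xi(w)) = 2 w xi(rho) + 4 |nabla_xi xi|^2 >= 0 ([along_along_sqnorm]).
    Suppose w > 0 somewhere and look at a maximum of the barrier
    F = N w + f^2. There xi(F) = 0 and xi(xi(F)) <= 0,
    and since xi(f) = w these two conditions give N w^2 <= 2 f^2 w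
    ([barrier_critical_bound]), which is impossible at a maximum of F once N is
    large compared with max f^2 / max w ([barrier_max_absurd]). Hence xi = 0: it
    is both affine Killing and Killing, and Ric(xi, .) = (1 - n) d rho now shows
    d rho = 0, so d lambda = 0 and lambda is constant on the connected manifold.

    The tensor identities are proved over an abstract commutative ring with
    commuting derivations, and used for the ring of smooth functions on the
    codomain of a chart, whose partial derivatives commute by
    [derive_symmetric]. The geometric hypotheses speak of global vector fields
    only; they are localised to coordinate fields by extending these with smooth
    plateau functions ([plateau], [extend_const]). *)

(** * Tensor calculus over a ring with commuting derivations *)

Section MatrixEntries.
Variables (A : pzRingType) (p q : nat).
Implicit Types M N : 'M[A]_(p, q).
Lemma mx_addE M N i j : (M + N) i j = M i j + N i j. Proof. by rewrite mxE. Qed.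
Lemma mx_oppE M i j : (- M) i j = - M i j. Proof. by rewrite mxE. Qed.
Lemma mx_scaleE x M i j : (x *: M) i j = x * M i j. Proof. by rewrite mxE. Qed.
End MatrixEntries.

Lemma tr_mxD (A : pzRingType) p q (M N : 'M[A]_(p, q)) :
  (M + N)^T = M^T + N^T.
Proof. exact: linearD. Qed.
Lemma tr_mxN (A : pzRingType) p q (M : 'M[A]_(p, q)) : (- M)^T = - M^T.
Proof. exact: linearN. Qed.
Lemma tr_mxZ (A : pzRingType) p q x (M : 'M[A]_(p, q)) : (x *: M)^T = x *: M^T.
Proof. exact: linearZ. Qed.

(** Closes additive identities between matrices whose products are expanded:
    entrywise every product is an atom. *)
Ltac mx_zmod :=
  let i := fresh in let j := fresh in
  apply/matrixP => i j; rewrite ?(mx_addE, mx_oppE, mx_scaleE); ring.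

Section TensorCalculus.
Variables (A : comPzRingType) (n : nat) (d : 'I_n -> {additive A -> A}).
Hypothesis dM : forall a x y, d a (x * y) = d a x * y + x * d a y.
Hypothesis dC : forall a b x, d a (d b x) = d b (d a x).
Hypothesis torsion_free : forall m (x : A), x *+ m.+1 = 0 -> x = 0.

Definition dmx a p q (M : 'M[A]_(p, q)) : 'M[A]_(p, q) := map_mx (d a) M.

Lemma dmxE a p q (M : 'M[A]_(p, q)) i j : dmx a M i j = d a (M i j).
Proof. exact: mxE. Qed.

Lemma dmxD a p q (M N : 'M[A]_(p, q)) : dmx a (M + N) = dmx a M + dmx a N.
Proof. exact: map_mxD. Qed.

Lemma dmxN a p q (M : 'M[A]_(p, q)) : dmx a (- M) = - dmx a M.
Proof. by apply/matrixP => i j; rewrite !mxE raddfN. Qed.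

Lemma dmxB a p q (M N : 'M[A]_(p, q)) : dmx a (M - N) = dmx a M - dmx a N.
Proof. exact: map_mxB. Qed.

Lemma dmxM a p q r (M : 'M[A]_(p, q)) (N : 'M[A]_(q, r)) :
  dmx a (M *m N) = dmx a M *m N + M *m dmx a N.
Proof.
apply/matrixP => i j; rewrite !mxE raddf_sum -big_split /=.
by apply: eq_bigr => k _; rewrite dM !mxE.
Qed.

Lemma dmxZ a p q x (M : 'M[A]_(p, q)) :
  dmx a (x *: M) = d a x *: M + x *: dmx a M.
Proof. by apply/matrixP => i j; rewrite !mxE dM. Qed.

Lemma dmxC a b p q (M : 'M[A]_(p, q)) : dmx a (dmx b M) = dmx b (dmx a M).
Proof. by apply/matrixP => i j; rewrite !mxE dC. Qed.

Lemma dmx_tr a p q (M : 'M[A]_(p, q)) : dmx a M^T = (dmx a M)^T.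
Proof. by rewrite /dmx map_trmx. Qed.

Lemma dmx_sum a (I : finType) p q (F : I -> 'M[A]_(p, q)) :
  dmx a (\sum_i F i) = \sum_i dmx a (F i).
Proof. exact: raddf_sum. Qed.

Lemma dmx_row a p q (M : 'M[A]_(p, q)) i : dmx a (row i M) = row i (dmx a M).
Proof. by rewrite /dmx map_row. Qed.

Variable Gamma : 'I_n -> 'M[A]_n.
Hypothesis Gamma_sym : forall a b, row b (Gamma a) = row a (Gamma b).

(** Row [l], column [k] holds the k-th component of R(d_a, d_b) d_l; the products
    come in reverse order because vectors are rows and matrices act on the right.
    The lock keeps rewriting from unfolding curvature terms into sums. *)
Definition Riem a b : 'M[A]_n := locked
  (dmx a (Gamma b) - dmx b (Gamma a) + Gamma b *m Gamma a - Gamma a *m Gamma b).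

Definition Ric : 'M[A]_n := \matrix_(b, l) \sum_a Riem a b l a.

(** The covariant derivative along d_a of a vector field, of an endomorphism
    field and of a bilinear form. *)
Definition cov_row a (u : 'rV[A]_n) : 'rV[A]_n :=
  locked (dmx a u + u *m Gamma a).
Definition cov_end a (E : 'M[A]_n) : 'M[A]_n :=
  locked (dmx a E + E *m Gamma a - Gamma a *m E).
Definition cov_form a (B : 'M[A]_n) : 'M[A]_n :=
  locked (dmx a B - Gamma a *m B - B *m (Gamma a)^T).

Lemma cov_formM a E B :
  cov_form a (E *m B) = cov_end a E *m B + E *m cov_form a B.
Proof.
rewrite /cov_form /cov_end -!lock dmxM mulmxBl !mulmxDl !mulmxBr !mulmxA.
mx_zmod.
Qed.

Lemma cov_form_comm a b B :
  cov_form a (cov_form b B) - cov_form b (cov_form a B)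
    = - (Riem a b *m B + B *m (Riem a b)^T).
Proof.
rewrite /cov_form /Riem -!lock !(dmxB, dmxM, dmx_tr) (dmxC b a B).
rewrite !(tr_mxD, tr_mxN, trmx_mul).
rewrite !(mulmxBl, mulmxDl, mulmxBr, mulmxDr) !mulmxA.
mx_zmod.
Qed.

Lemma cov_row_comm a b u :
  cov_row a (cov_row b u) - cov_row b (cov_row a u) = u *m Riem a b.
Proof.
rewrite /cov_row /Riem -!lock !(dmxD, dmxM) (dmxC b a u).
rewrite !(mulmxBr, mulmxDr, mulmxDl) !mulmxA.
mx_zmod.
Qed.

(** Jacobi identity for the operators nabla_a, nabla_b, nabla_c, whose pairwise
    commutators are the curvature endomorphisms. *)
Lemma cov_end_bianchi a b c :
  cov_end a (Riem b c) + cov_end b (Riem c a) + cov_end c (Riem a b) = 0.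
Proof.
rewrite /cov_end /Riem -!lock !(dmxN, dmxD, dmxM).
rewrite (dmxC b a) (dmxC c a) (dmxC c b).
rewrite !(mulmxBr, mulmxDr, mulmxBl, mulmxDl) !mulmxA.
apply/matrixP => i j; rewrite ?(mx_addE, mx_oppE) [RHS]mxE; ring.
Qed.

(** The full covariant derivative of the curvature: [cov_end] differentiates the
    endomorphism R(d_a, d_b), the two sums correct for the slots [a] and [b]. *)
Definition cov_Riem c a b : 'M[A]_n := locked
  (cov_end c (Riem a b) - \sum_e Gamma c a e *: Riem e b
   - \sum_e Gamma c b e *: Riem a e).

Lemma Riem_skew a b : Riem b a = - Riem a b.
Proof. rewrite /Riem -!lock; mx_zmod. Qed.

Lemma cov_end_opp c E : cov_end c (- E) = - cov_end c E.
Proof.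
rewrite /cov_end -!lock mulNmx mulmxN dmxN.
mx_zmod.
Qed.

Lemma cov_Riem_skew c a b : cov_Riem c b a = - cov_Riem c a b.
Proof.
rewrite /cov_Riem -!lock Riem_skew cov_end_opp.
under eq_bigr do rewrite Riem_skew scalerN.
under [X in _ - _ - X]eq_bigr do rewrite Riem_skew scalerN.
rewrite !sumrN; mx_zmod.
Qed.

Lemma Gamma_symE a b k : Gamma a b k = Gamma b a k.
Proof. by have /rowP/(_ k) := Gamma_sym a b; rewrite !mxE. Qed.

(** For a symmetric connection the corrections for the form slots cancel in the
    cyclic sum, because [Riem] is skew in its two indices. *)
Lemma bianchi a b c : cov_Riem a b c + cov_Riem b c a + cov_Riem c a b = 0.
Proof.
rewrite -(cov_end_bianchi a b c) /cov_Riem -!lock.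
have E x y z : \sum_e Gamma x y e *: Riem e z = - \sum_e Gamma y x e *: Riem z e.
  by rewrite -sumrN; apply: eq_bigr => e _; rewrite Gamma_symE Riem_skew scalerN.
rewrite (E a b c) (E b c a) (E c a b); mx_zmod.
Qed.

Lemma cov_RiemE c a b l k : cov_Riem c a b l k =
  d c (Riem a b l k) + \sum_e Riem a b l e * Gamma c e k
  - \sum_e Gamma c l e * Riem a b e k
  - \sum_e Gamma c a e * Riem e b l k - \sum_e Gamma c b e * Riem a e l k.
Proof.
rewrite /cov_Riem /cov_end -!lock !(mx_addE, mx_oppE) dmxE !summxE.
congr (_ + _ - _ - _ - _); last 2 first.
- by apply: eq_bigr => e _; rewrite mx_scaleE.
- by apply: eq_bigr => e _; rewrite mx_scaleE.
- by rewrite mxE.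
- by rewrite mxE.
Qed.

(** The connection terms for the contracted pair of indices cancel each other, so
    the trace may be taken before or after differentiating. *)
Lemma cov_Ric c b l : (cov_form c Ric) b l = \sum_a cov_Riem c a b l a.
Proof.
under eq_bigr do rewrite cov_RiemE.
rewrite !(sumrB, big_split) /=.
rewrite /cov_form -!lock !(mx_addE, mx_oppE) dmxE [Ric b l]mxE raddf_sum /=.
rewrite ![(_ *m _) _ _]mxE.
have -> : \sum_j Gamma c b j * Ric j l = \sum_a \sum_e Gamma c b e * Riem a e l a.
  rewrite exchange_big; apply: eq_bigr => e _ /=; rewrite mxE mulr_sumr.
  by apply: eq_bigr.
have -> : \sum_j Ric b j * (Gamma c)^T j l
    = \sum_a \sum_e Gamma c l e * Riem a b e a.
  rewrite exchange_big; apply: eq_bigr => e _ /=; rewrite mxE mulr_suml mxE.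
  by apply: eq_bigr => k _; rewrite mulrC.
have -> : \sum_a \sum_e Gamma c a e * Riem e b l a
    = \sum_a \sum_e Riem a b l e * Gamma c e a.
  rewrite exchange_big; apply: eq_bigr => j _; apply: eq_bigr => i _.
  by rewrite mulrC.
ring.
Qed.

Section Metric.
Variables g gi : 'M[A]_n.
Hypotheses (g_sym : g^T = g) (ggi : g *m gi = 1%:M).
Hypothesis g_par : forall a, cov_form a g = 0.

Lemma dmx_g a : dmx a g = Gamma a *m g + g *m (Gamma a)^T.
Proof.
by apply/eqP; rewrite -subr_eq0 -(g_par a) /cov_form -!lock opprD addrA.
Qed.

Lemma gig : gi *m g = 1%:M.
Proof. exact: mulmx1C. Qed.

Lemma gi_sym : gi^T = gi.
Proof.
have gT : gi^T *m g = 1%:M by rewrite -{1}g_sym -trmx_mul ggi trmx1.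
by rewrite -[LHS]mulmx1 -ggi mulmxA gT mul1mx.
Qed.

Lemma skew_form0 B : 0 = - (B *m g + g *m B^T) -> (B *m g)^T = - (B *m g).
Proof.
move/eqP; rewrite eq_sym oppr_eq0 addrC addr_eq0 trmx_mul g_sym => /eqP //.
Qed.

(** A parallel metric has vanishing second covariant derivatives, and their
    commutator is the symmetrized curvature. *)
Lemma Riem_form_skew a b : (Riem a b *m g)^T = - (Riem a b *m g).
Proof.
apply: skew_form0; rewrite -cov_form_comm !g_par /cov_form -!lock.
have dmx0 c : dmx c 0 = 0 :> 'M[A]_n by apply/matrixP=> i j; rewrite !mxE raddf0.
by rewrite !dmx0 !mulmx0 !mul0mx !subrr.
Qed.

Lemma cov_Riem_form_skew c a b : (cov_Riem c a b *m g)^T = - (cov_Riem c a b *m g).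
Proof.
have C E : cov_end c E *m g = cov_form c (E *m g).
  by rewrite cov_formM g_par mulmx0 addr0.
have CT B : (cov_form c B)^T = cov_form c B^T.
  rewrite /cov_form -!lock !(tr_mxD, tr_mxN, trmx_mul) trmxK dmx_tr; mx_zmod.
have CN B : cov_form c (- B) = - cov_form c B.
  rewrite /cov_form -!lock dmxN mulNmx mulmxN; mx_zmod.
have S (h : 'I_n -> A) (E : 'I_n -> 'M[A]_n) :
    (forall e, (E e *m g)^T = - (E e *m g)) ->
    ((\sum_e h e *: E e) *m g)^T = - ((\sum_e h e *: E e) *m g).
  move=> E_skew; rewrite mulmx_suml linear_sum -sumrN /=.
  by apply: eq_bigr => e _; rewrite -scalemxAl tr_mxZ E_skew scalerN.
have -> : cov_Riem c a b *m g = cov_form c (Riem a b *m g)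
    - (\sum_e Gamma c a e *: Riem e b) *m g - (\sum_e Gamma c b e *: Riem a e) *m g.
  by rewrite /cov_Riem -!lock 2!mulmxBl C.
rewrite tr_mxD tr_mxN tr_mxD tr_mxN CT Riem_form_skew CN !S; last first.
- by move=> e; exact: Riem_form_skew.
- by move=> e; exact: Riem_form_skew.
mx_zmod.
Qed.

Lemma trace_ggi : \sum_b \sum_l g b l * gi b l = n%:R.
Proof.
transitivity (\tr (g *m gi)).
  apply: eq_bigr => b _; rewrite mxE; apply: eq_bigr => l _.
  by rewrite -{1}gi_sym mxE.
by rewrite ggi mxtrace1.
Qed.

(** The twice contracted second Bianchi identity, for a tensor [N] that has the
    symmetries of the covariant derivative of the curvature and whose trace is
    [s c * g]. One trace of the cyclic identity leaves a divergence of [N]; the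
    second trace turns it, by skewness of [N c a b] with respect to [g], into
    minus the trace of the Ricci derivative, and the identity becomes
    s - n s = - s. *)
Lemma contracted_bianchi (N : 'I_n -> 'I_n -> 'I_n -> 'M[A]_n) (s : 'I_n -> A) :
  (forall a b c, N a b c + N b c a + N c a b = 0) ->
  (forall c a b, N c b a = - N c a b) ->
  (forall c a b, (N c a b *m g)^T = - (N c a b *m g)) ->
  (forall c b l, \sum_a N c a b l a = s c * g b l) ->
  forall c, (n%:R - 2) * s c = 0.
Proof.
move=> N_cyclic N_skew N_form_skew N_trace c.
have tr_b b l : \sum_a N a b c l a = s b * g c l - s c * g b l.
  have : \sum_a (N a b c + N b c a + N c a b) l a = 0.
    by rewrite big1 // => a _; rewrite N_cyclic mxE.
  under eq_bigr => a _ do rewrite 2!mx_addE (N_skew b a c) (mx_oppE (N b a c)).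
  rewrite big_split /= big_split /= sumrN !N_trace => /eqP.
  by rewrite -addrA addr_eq0 => /eqP ->; ring.
have giN a b : gi *m N a b c = - ((N a b c)^T *m gi).
  have := N_form_skew a b c; rewrite trmx_mul g_sym => h.
  rewrite -[LHS]mulmx1 -ggi -mulmxA (mulmxA _ g) -[_ *m g]opprK -h.
  by rewrite mulNmx mulmxN !mulmxA gig mul1mx.
have gdelta (h : 'I_n -> A) : \sum_b \sum_l gi b l * (h b * g c l) = h c.
  transitivity (\sum_b h b * (b == c)%:R).
    apply: eq_bigr => b _; rewrite (_ : (b == c)%:R = (gi *m g) b c).
      rewrite mxE mulr_sumr; apply: eq_bigr => l _.
      by rewrite -{1}g_sym mxE; ring.
    by rewrite gig mxE.
  rewrite (bigD1 c) //= eqxx mulr1 big1 ?addr0 // => b /negPf ->.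
  by rewrite mulr0.
have : \sum_a \sum_b (gi *m N a b c) b a
     = - \sum_a \sum_p s a * g c p * gi p a.
  rewrite -sumrN; apply: eq_bigr => a _; rewrite -sumrN.
  under eq_bigr do rewrite giN mx_oppE mxE -sumrN.
  rewrite exchange_big /=; apply: eq_bigr => p _.
  rewrite sumrN -N_trace mulr_suml; congr (- _); apply: eq_bigr => b _.
  by rewrite mxE.
have -> : \sum_a \sum_p s a * g c p * gi p a = s c.
  rewrite -[RHS]gdelta; apply: eq_bigr => a _; apply: eq_bigr => p _.
  by rewrite -{1}gi_sym mxE; ring.
have -> : \sum_a \sum_b (gi *m N a b c) b a = s c - n%:R * s c.
  transitivity (\sum_b \sum_l (gi b l * (s b * g c l) - s c * (g b l * gi b l))).
    rewrite exchange_big /=; apply: eq_bigr => b _.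
    under eq_bigr do rewrite mxE.
    rewrite exchange_big /=; apply: eq_bigr => l _.
    by rewrite -mulr_sumr tr_b; ring.
  under eq_bigr do rewrite sumrB -mulr_sumr.
  rewrite sumrB gdelta -mulr_sumr trace_ggi; ring.
move=> /eqP; rewrite -subr_eq0 => /eqP h.
by rewrite -[RHS]oppr0 -h; ring.
Qed.


(** Schur's lemma for a Ricci tensor whose covariant derivative is pure trace. *)
Lemma schur (s : 'I_n -> A) :
  (forall c, cov_form c Ric = s c *: g) -> forall c, (n%:R - 2) * s c = 0.
Proof.
move=> hs; apply: (contracted_bianchi bianchi cov_Riem_skew cov_Riem_form_skew).
by move=> c b l; rewrite -cov_Ric hs mxE.
Qed.

(** * Affine conformal Killing gradient fields *)

Variables (xi : 'rV[A]_n) (f rho lam : A).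
Definition differential (h : A) : 'rV[A]_n := \row_a d a h.
Hypothesis xi_grad : differential f = xi *m g.

Definition partials : 'M[A]_n := \matrix_(a, k) d a (xi 0 k).
Definition xiGamma : 'M[A]_n := \sum_c xi 0 c *: Gamma c.
(** Row [a] is nabla_a xi (see [row_nabla_xi]): by symmetry of the connection
    xi^c Gamma_ac^k can be written as the k-th entry of row [a] of [xiGamma]. *)
Definition nabla_xi := partials + xiGamma.
(** Row [b], column [k] holds the k-th component of (L_xi nabla)(d_a, d_b), from
    the coordinate formula for the Lie derivative of a connection. *)
Definition lie_Gamma a : 'M[A]_n :=
  \sum_c xi 0 c *: dmx c (Gamma a) - Gamma a *m partials
  + \sum_c partials a c *: Gamma c
  + dmx a partials + partials *m Gamma a.
Definition lie_form : 'M[A]_n :=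
  \sum_c xi 0 c *: dmx c g + partials *m g + (partials *m g)^T.

Lemma lie_GammaE a b k : lie_Gamma a b k =
  \sum_c xi 0 c * d c (Gamma a b k) - \sum_e Gamma a b e * d e (xi 0 k)
  + \sum_c d a (xi 0 c) * Gamma c b k + d a (d b (xi 0 k))
  + \sum_e d b (xi 0 e) * Gamma a e k.
Proof.
rewrite /lie_Gamma !(mx_addE, mx_oppE) !summxE dmxE [partials b k]mxE.
congr (_ - _ + _ + _ + _).
- by apply: eq_bigr => c _; rewrite mx_scaleE dmxE.
- by rewrite mxE; apply: eq_bigr => e _; rewrite [partials e k]mxE.
- by apply: eq_bigr => c _; rewrite mx_scaleE [partials a c]mxE.
- by rewrite mxE; apply: eq_bigr => e _; rewrite [partials b e]mxE.
Qed.

Lemma lie_formE a b : lie_form a b = \sum_c xi 0 c * d c (g a b)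
  + \sum_c d a (xi 0 c) * g c b + \sum_c d b (xi 0 c) * g c a.
Proof.
rewrite /lie_form !mx_addE summxE; congr (_ + _ + _).
- by apply: eq_bigr => c _; rewrite mx_scaleE dmxE.
- by rewrite mxE; apply: eq_bigr => e _; rewrite [partials a e]mxE.
- by rewrite mxE mxE; apply: eq_bigr => e _; rewrite [partials b e]mxE.
Qed.

Lemma RiemE a b l k : Riem a b l k = d a (Gamma b l k) - d b (Gamma a l k)
  + \sum_e Gamma b l e * Gamma a e k - \sum_e Gamma a l e * Gamma b e k.
Proof.
by rewrite /Riem -lock !(mx_addE, mx_oppE) !dmxE [X in _ + X - _]mxE [X in _ - X]mxE.
Qed.

Lemma row_nabla_xi a : row a nabla_xi = cov_row a xi.
Proof.
apply/rowP => k; rewrite /cov_row -!lock !(mxE, mx_addE) summxE; congr (_ + _).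
by apply: eq_bigr => c _; rewrite mxE Gamma_symE.
Qed.

(** L_xi nabla is the second covariant derivative of xi plus the curvature
    contracted with xi. *)
Lemma lie_Gamma_cov a : lie_Gamma a = cov_end a nabla_xi + \sum_c xi 0 c *: Riem c a.
Proof.
have d_xiGamma : dmx a xiGamma = \sum_c partials a c *: Gamma c
    + \sum_c xi 0 c *: dmx a (Gamma c).
  rewrite /xiGamma dmx_sum -big_split; apply: eq_bigr => c _ /=.
  by rewrite dmxZ [partials a c]mxE.
have R : \sum_c xi 0 c *: Riem c a = \sum_c xi 0 c *: dmx c (Gamma a)
   - \sum_c xi 0 c *: dmx a (Gamma c) + Gamma a *m xiGamma - xiGamma *m Gamma a.
  rewrite /xiGamma mulmx_sumr mulmx_suml -sumrB -big_split -sumrB.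
  by apply: eq_bigr => c _ /=; rewrite /Riem -!lock -scalemxAl -scalemxAr; mx_zmod.
rewrite R /lie_Gamma /nabla_xi /cov_end -!lock dmxD d_xiGamma mulmxDl mulmxDr; mx_zmod.
Qed.

(** For xi = grad f this matrix is the Hessian
    d_a d_b f - Gamma_ab^k d_k f, symmetric because derivations commute. *)
Lemma hess_sym : (nabla_xi *m g)^T = nabla_xi *m g.
Proof.
have H a b : (nabla_xi *m g) a b
    = d a (d b f) - \sum_k differential f 0 k * Gamma a b k.
  have -> : d a (d b f) = dmx a (differential f) 0 b by rewrite !mxE.
  have -> : \sum_k differential f 0 k * Gamma a b k = (xi *m g *m (Gamma a)^T) 0 b.
    by rewrite -xi_grad [RHS]mxE; apply: eq_bigr => k _; rewrite [_^T _ _]mxE.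
  have -> : (nabla_xi *m g) a b = (row a nabla_xi *m g) 0 b.
    by rewrite -row_mul [RHS]mxE.
  rewrite row_nabla_xi xi_grad dmxM /cov_row -!lock dmx_g.
  rewrite !(mulmxDl, mulmxDr) !mulmxA.
  rewrite !mx_addE; ring.
apply/matrixP => b a; rewrite mxE !H dC; congr (_ - _).
by apply: eq_bigr => k _; rewrite Gamma_symE.
Qed.

Lemma two_torsion p q (M : 'M[A]_(p, q)) : M + M = 0 -> M = 0.
Proof.
move=> /matrixP h; apply/matrixP => i j.
by rewrite mxE; apply: (torsion_free (m := 1)); rewrite mulr2n -mx_addE h mxE.
Qed.

Lemma cov_form_tr a B : (cov_form a B)^T = cov_form a B^T.
Proof. rewrite /cov_form -!lock !(tr_mxD, tr_mxN, trmx_mul) trmxK dmx_tr; mx_zmod. Qed.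

Hypothesis xi_conf : forall a, lie_Gamma a =
  d a rho *: 1%:M + (differential rho)^T *m delta_mx 0 a
  - (row a g)^T *m (differential rho *m gi).

(** Lowering an index in the formula for L_xi nabla gives the derivative of the
    Hessian, symmetric in its two slots, plus a curvature term, skew in them.
    The prescribed value of L_xi nabla has symmetric part d_a rho * g, so adding
    the transpose isolates the derivative of the Hessian. *)
Lemma cov_nabla_xi a : cov_end a nabla_xi = d a rho *: 1%:M.
Proof.
suff h : cov_end a nabla_xi *m g = d a rho *: g.
  by rewrite -[LHS]mulmx1 -ggi mulmxA h -scalemxAl.
have N_sym : (cov_end a nabla_xi *m g)^T = cov_end a nabla_xi *m g.
  have -> : cov_end a nabla_xi *m g = cov_form a (nabla_xi *m g).
    by rewrite cov_formM g_par mulmx0 addr0.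
  by rewrite cov_form_tr hess_sym.
have R_skew : ((\sum_c xi 0 c *: Riem c a) *m g)^T
    = - ((\sum_c xi 0 c *: Riem c a) *m g).
  rewrite mulmx_suml linear_sum -sumrN /=.
  apply: eq_bigr => c _; rewrite -scalemxAl tr_mxZ Riem_form_skew.
  by rewrite scalerN.
have lie_Gamma_g : lie_Gamma a *m g = d a rho *: g
    + ((differential rho)^T *m row a g - (row a g)^T *m differential rho).
  rewrite xi_conf mulmxBl mulmxDl -scalemxAl mul1mx -!mulmxA gig mulmx1.
  by rewrite -rowE addrA.
have := congr1 (fun B => B + B^T) lie_Gamma_g.
rewrite lie_Gamma_cov mulmxDl !(tr_mxD, tr_mxN, tr_mxZ) N_sym R_skew.
rewrite !trmx_mul !trmxK g_sym => h.
apply/eqP; rewrite -subr_eq0; apply/eqP/two_torsion.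
rewrite -[RHS](subrr (cov_end a nabla_xi *m g + (\sum_c xi 0 c *: Riem c a) *m g +
    (cov_end a nabla_xi *m g - (\sum_c xi 0 c *: Riem c a) *m g))) {2}h.
mx_zmod.
Qed.

(** Ricci identity: the curvature of xi is the antisymmetrized second covariant
    derivative, which [cov_nabla_xi] has computed. *)
Lemma Riem_xi a b : xi *m Riem a b = d a rho *: delta_mx 0 b - d b rho *: delta_mx 0 a.
Proof.
have N e c : row c (cov_end e nabla_xi) = cov_row e (cov_row c xi)
    - \sum_k Gamma e c k *: row k nabla_xi.
  rewrite -row_nabla_xi /cov_end /cov_row -!lock linearB linearD /= dmx_row row_mul.
  congr (_ + _ - _).
  apply/rowP => k; rewrite !mxE summxE.
  by apply: eq_bigr => l _; rewrite !mxE.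
rewrite -cov_row_comm -[X in X - _](subrK (\sum_k Gamma a b k *: row k nabla_xi)).
rewrite -N -[X in _ - X](subrK (\sum_k Gamma b a k *: row k nabla_xi)) -N !cov_nabla_xi.
under eq_bigr do rewrite Gamma_symE.
rewrite !linearZ /= !row1; mx_zmod.
Qed.

Lemma Ric_xi : xi *m Ric^T = (1 - n%:R) *: differential rho.
Proof.
apply/rowP => b; rewrite mxE.
transitivity (\sum_a (xi *m Riem a b) 0 a).
  under eq_bigr do rewrite !mxE mulr_sumr.
  rewrite exchange_big; apply: eq_bigr => a _ /=.
  by rewrite mxE.
under eq_bigr do rewrite Riem_xi !(mx_addE, mx_oppE, mx_scaleE, mxE) eqxx /=.
rewrite sumrB (bigD1 b) //= eqxx !mulr1 big1 ?addr0; last first.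
  by move=> a /negPf ab; rewrite ab mulr0.
under eq_bigr do rewrite eqxx mulr1.
by rewrite sumr_const cardT size_enum_ord !mxE -mulr_natl; ring.
Qed.

Hypothesis soliton : lie_form + Ric + Ric = (lam + lam) *: g.

Lemma lie_form_hess : lie_form = nabla_xi *m g + nabla_xi *m g.
Proof.
have xiGamma_g : \sum_c xi 0 c *: dmx c g = xiGamma *m g + (xiGamma *m g)^T.
  rewrite /xiGamma trmx_mul linear_sum mulmx_suml mulmx_sumr -big_split.
  apply: eq_bigr => c _ /=; rewrite g_sym tr_mxZ -scalemxAl -scalemxAr.
  by rewrite -scalerDr dmx_g.
rewrite -{2}hess_sym /lie_form xiGamma_g /nabla_xi mulmxDl tr_mxD; mx_zmod.
Qed.

(** L_xi g is twice the Hessian, so the soliton equation reads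
    Ric = lam g - Hess f. *)
Lemma Ric_hess : Ric = lam *: g - nabla_xi *m g.
Proof.
apply/eqP; rewrite -subr_eq0; apply/eqP/two_torsion.
transitivity (lie_form + Ric + Ric - lie_form
    - ((lam + lam) *: g - (nabla_xi *m g + nabla_xi *m g))).
  mx_zmod.
rewrite soliton lie_form_hess subrr //.
Qed.

(** By [Ric_hess] and [cov_nabla_xi] the covariant derivative of Ric is
    d(lam - rho) times g, so Schur's lemma applies. *)
Lemma differential_lam_rho c : (n%:R - 2) * (d c lam - d c rho) = 0.
Proof.
apply: (schur (s := fun c => d c lam - d c rho)) => {}c.
have -> : Ric = (lam *: 1%:M - nabla_xi) *m g.
  by rewrite mulmxBl -scalemxAl mul1mx Ric_hess.
rewrite cov_formM g_par mulmx0 addr0.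
have -> : cov_end c (lam *: 1%:M - nabla_xi) = d c lam *: 1%:M - cov_end c nabla_xi.
  rewrite /cov_end -!lock dmxB dmxZ mulmxBl mulmxBr.
  have -> : dmx c (1%:M : 'M[A]_n) = 0.
    apply/matrixP => i j; rewrite !mxE.
    have d1 : d c 1 = 0.
      by apply: (addrI (d c 1)); rewrite addr0 -{3}[1]mulr1 dM mulr1 mul1r.
    by case: (i == j); rewrite ?raddf0.
  rewrite -scalemxAl -scalemxAr mul1mx mulmx1 scaler0 addr0; mx_zmod.
by rewrite cov_nabla_xi -scalerBl -scalemxAl mul1mx.
Qed.

Lemma Ric_xi_form : (lam *: xi - xi *m nabla_xi) *m g = (1 - n%:R) *: differential rho.
Proof.
rewrite -Ric_xi Ric_hess tr_mxD tr_mxN tr_mxZ g_sym hess_sym mulmxBr.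
by rewrite mulmxBl -scalemxAl -scalemxAr mulmxA.
Qed.

Definition along (h : A) : A := \sum_c xi 0 c * d c h.
Definition sqnorm : A := (xi *m g *m xi^T) 0 0.
(** The vector field nabla_xi xi. *)
Definition accel : 'rV[A]_n := xi *m nabla_xi.

Lemma along_potential : along f = sqnorm.
Proof.
rewrite /sqnorm -xi_grad mxE; apply: eq_bigr => c _.
by rewrite !mxE mulrC.
Qed.

Lemma form_sym (B : 'M[A]_n) (u v : 'rV[A]_n) : B^T = B ->
  (u *m B *m v^T) 0 0 = (v *m B *m u^T) 0 0.
Proof.
move=> Bs; rewrite -[in RHS]Bs -[in RHS](trmxK v) -!trmx_mul mulmxA.
by rewrite [in RHS]mxE.
Qed.

Lemma d_form a B : B^T = B ->
  d a ((xi *m B *m xi^T) 0 0) = (xi *m cov_form a B *m xi^T) 0 0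
   + (row a nabla_xi *m B *m xi^T) 0 0 + (row a nabla_xi *m B *m xi^T) 0 0.
Proof.
move=> Bs; rewrite -dmxE !dmxM dmx_tr [X in _ = _ + X](form_sym _ _ Bs) row_nabla_xi.
rewrite /cov_form /cov_row -!lock.
rewrite !(tr_mxD, trmx_mul).
rewrite !(mulmxDl, mulmxDr, mulNmx, mulmxN) !mulmxA.
rewrite !(mulNmx, mx_addE, mx_oppE).
ring.
Qed.

Lemma along_form B : B^T = B -> along ((xi *m B *m xi^T) 0 0)
  = \sum_c xi 0 c * (xi *m cov_form c B *m xi^T) 0 0
   + (accel *m B *m xi^T) 0 0 + (accel *m B *m xi^T) 0 0.
Proof.
move=> Bs; rewrite /along; under eq_bigr do rewrite d_form // !mulrDr.
rewrite !big_split /=.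
have -> : (accel *m B *m xi^T) 0 0 = \sum_c xi 0 c * (row c nabla_xi *m B *m xi^T) 0 0.
  rewrite /accel -!(mulmxA xi) mxE; apply: eq_bigr => c _.
  by rewrite -!row_mul [X in _ = _ * X]mxE.
by [].
Qed.

Lemma along_sqnorm : along sqnorm = (xi *m (nabla_xi *m g) *m xi^T) 0 0 *+ 2.
Proof.
rewrite /sqnorm along_form // big1 ?add0r; first by rewrite mulr2n /accel !mulmxA.
by move=> c _; rewrite g_par mulmx0 mul0mx mxE mulr0.
Qed.

Lemma alongD (x y : A) : along (x + y) = along x + along y.
Proof.
by rewrite /along -big_split; apply: eq_bigr => c _ /=; rewrite raddfD mulrDr.
Qed.

(** The identity behind the maximum principle: along xi, |xi|^2 is convex up to
    the sign of xi(rho). It follows from xi|xi|^2 = 2 Hess f(xi, xi) and from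
    the derivative of the Hessian being d rho times g. *)
Lemma along_along_sqnorm :
  along (along sqnorm) = (sqnorm * along rho) *+ 2 + (accel *m g *m accel^T) 0 0 *+ 4.
Proof.
rewrite along_sqnorm mulr2n alongD along_form ?hess_sym //.
have -> : (accel *m (nabla_xi *m g) *m xi^T) 0 0 = (accel *m g *m accel^T) 0 0.
  by rewrite -hess_sym trmx_mul g_sym /accel [in RHS]trmx_mul !mulmxA.
have -> : \sum_c xi 0 c * (xi *m cov_form c (nabla_xi *m g) *m xi^T) 0 0
    = sqnorm * along rho.
  rewrite /along mulr_sumr; apply: eq_bigr => c _.
  rewrite cov_formM g_par mulmx0 addr0 cov_nabla_xi -scalemxAl mul1mx.
  by rewrite -scalemxAr -scalemxAl mx_scaleE -/sqnorm; ring.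
ring.
Qed.

Lemma along_sum_form (B : 'rV[A]_n) h : B = differential h ->
  (B *m xi^T) 0 0 = along h.
Proof.
by move=> ->; rewrite mxE; apply: eq_bigr => c _; rewrite !mxE mulrC.
Qed.

Lemma xi_differential_rho :
  xi *m ((lam%:M - nabla_xi) *m g) = (1 - n%:R) *: differential rho.
Proof. by rewrite mulmxA mulmxBr mul_mx_scalar Ric_xi_form. Qed.

Lemma Ric_xi_xi : lam * sqnorm - (xi *m (nabla_xi *m g) *m xi^T) 0 0
  = (1 - n%:R) * along rho.
Proof.
have := congr1 (fun u : 'rV_n => (u *m xi^T) 0 0) Ric_xi_form.
rewrite -[in RHS]scalemxAl [RHS]mx_scaleE (along_sum_form (erefl _)) => <-.
rewrite mulmxBl mulmxBl -!scalemxAl mx_addE mx_oppE mx_scaleE.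
by rewrite !mulmxA.
Qed.

Lemma alongM (x y : A) : along (x * y) = along x * y + x * along y.
Proof.
rewrite /along mulr_suml mulr_sumr -big_split; apply: eq_bigr => c _ /=.
by rewrite dM; ring.
Qed.

Lemma alongMn x N : along (x *+ N) = along x *+ N.
Proof.
rewrite /along -sumrMnl; apply: eq_bigr => c _; by rewrite raddfMn mulrnAr.
Qed.

Lemma along_barrier N : along (sqnorm *+ N + f * f)
  = along sqnorm *+ N + (f * sqnorm) *+ 2.
Proof.
by rewrite alongD alongMn alongM along_potential mulr2n; congr (_ + _); ring.
Qed.

Lemma along_along_barrier N : along (along (sqnorm *+ N + f * f))
  = along (along sqnorm) *+ N + (sqnorm * sqnorm + f * along sqnorm) *+ 2.
Proof.
by rewrite along_barrier alongD !alongMn alongM along_potential.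
Qed.
End Metric.
End TensorCalculus.

(** * Functions of class C^k *)

Lemma near_eq_continuous (T U : topologicalType) (f g : T -> U) (x : T) :
  {near x, f =1 g} -> {for x, continuous f} -> {for x, continuous g}.
Proof.
move=> fg fc; have fgx := nbhs_singleton fg.
have {}fc : f @ x --> g x by rewrite -fgx; exact: fc.
apply: cvg_trans fc; exact: near_eq_cvg.
Qed.

(** The two functions have the same first-order expansion at [x]. *)
Lemma near_eq_differentiable (R : numFieldType) (V W : normedModType R)
    (f g : V -> W) (x : V) :
  {near x, f =1 g} -> differentiable f x -> differentiable g x.
Proof.
move=> fg df; have fgx := nbhs_singleton fg.
have [dc dE] := (diff_locallyP _ _).1 df.
have gE : g \o shift x = cst (g x) + 'd f x +o_ 0 id.
  apply/eqaddoP => e e0; move/eqaddoP : dE => /(_ e e0) H.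
  have fg0 : \forall h \near 0, f (h + x) = g (h + x).
    have : \forall y \near x, f y = g y by exact: fg.
    by rewrite (near_shift 0) /= subr0.
  near=> h; have -> : (g \o shift x - (cst (g x) + 'd f x)) h =
     (f \o shift x - (cst (f x) + 'd f x)) h.
    by rewrite !fctE /= -fgx; congr (_ - _); apply/esym; near: h.
  by near: h.
by apply/diff_locallyP; rewrite (diff_unique dc gE).
Unshelve. all: by end_near. Qed.

Section ClassC.
Variables (R : realType) (n : nat).
Implicit Types (U V : set 'rV[R]_n) (W : normedModType R).

Lemma open_near U (x : 'rV[R]_n) (P : 'rV[R]_n -> Prop) :
  open U -> U x -> (forall y, U y -> P y) -> \near x, P x.
Proof.
move=> oU Ux UP; apply: (filterS UP).
exact: (open_nbhs_nbhs (conj oU Ux)).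
Qed.

Lemma class_C_ext W k U (f g : 'rV[R]_n -> W) :
  open U -> (forall x, U x -> f x = g x) -> class_C k U f -> class_C k U g.
Proof.
move=> oU; elim: k f g => [|k IH] f g fg /=.
  by move=> fC x Ux; apply: near_eq_continuous (fC x Ux); exact: (open_near oU).
move=> [fd fk]; split=> [x Ux|v].
  by apply: near_eq_differentiable (fd x Ux); exact: (open_near oU).
apply: IH (fk v) => x Ux; apply: near_eq_derive; exact: (open_near oU).
Qed.

Lemma class_C_sub W k U V (f : 'rV[R]_n -> W) :
  V `<=` U -> class_C k U f -> class_C k V f.
Proof.
move=> VU; elim: k f => [|k IH] f /= => [fC x /VU|[fd fk]]; first exact: fC.
by split=> [x /VU|v]; [exact: fd|exact/IH/fk].
Qed.

Lemma class_C_local W k U (f : 'rV[R]_n -> W) :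
  (forall x, U x -> exists2 V, V x & class_C k V f) -> class_C k U f.
Proof.
elim: k f => [|k IH] f fC /=.
  by move=> x /fC [V Vx]; apply.
split=> [x /fC [V Vx [fd _]]|v]; first exact: fd.
by apply: IH => x /fC [V Vx [_ fk]]; exists V => //; exact: fk.
Qed.

Lemma class_C_continuous W k U (f : 'rV[R]_n -> W) x :
  class_C k U f -> U x -> {for x, continuous f}.
Proof.
case: k => [|k] /=; first exact.
by move=> [fd _] /fd; exact: differentiable_continuous.
Qed.

Lemma class_C_lower W k U (f : 'rV[R]_n -> W) :
  class_C k.+1 U f -> class_C k U f.
Proof.
elim: k f => [|k IH] f /=.
  by move=> fC x; exact: (@class_C_continuous _ 1).
by move=> [fd fk]; split=> // v; apply: IH; exact: fk.
Qed.

Lemma class_C_cst W k U (a : W) : open U -> class_C k U (cst a).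
Proof.
move=> oU; elim: k a => [|k IH] a /=; first by move=> x _; exact: cst_continuous.
split=> [x _|v]; first exact: differentiable_cst.
by apply: (class_C_ext oU) (IH 0) => x _; rewrite derive_cst.
Qed.

Lemma class_C_add W k U (f g : 'rV[R]_n -> W) : open U ->
  class_C k U f -> class_C k U g -> class_C k U (f \+ g).
Proof.
move=> oU; elim: k f g => [|k IH] f g /=.
  by move=> fC gC x Ux; apply: continuousD; [exact: fC|exact: gC].
move=> [fd fk] [gd gk]; split=> [x Ux|v].
  by apply: differentiableD; [exact: fd|exact: gd].
apply: (class_C_ext oU) (IH _ _ (fk v) (gk v)) => x Ux /=.
by rewrite deriveD //; apply: diff_derivable; [exact: fd|exact: gd].
Qed.

Lemma class_C_mul k U (f g : 'rV[R]_n -> R) : open U ->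
  class_C k U f -> class_C k U g -> class_C k U (f \* g).
Proof.
move=> oU; elim: k f g => [|k IH] f g.
  by move=> fC gC x Ux; apply: continuousM; [exact: fC|exact: gC].
move=> fC gC; have fk := class_C_lower fC; have gk := class_C_lower gC.
case: fC gC => fd fk' [gd gk'] /=; split=> [x Ux|v].
  by apply: differentiableM; [exact: fd|exact: gd].
apply: (class_C_ext oU)
  (class_C_add oU (IH _ _ fk (gk' v)) (IH _ _ gk (fk' v))) => x Ux /=.
by rewrite deriveM //; apply: diff_derivable; [exact: fd|exact: gd].
Qed.

Lemma class_C_opp k U (f : 'rV[R]_n -> R) : open U ->
  class_C k U f -> class_C k U (\- f).
Proof.
move=> oU fC; apply: (class_C_ext oU) (class_C_mul oU (class_C_cst k (-1 : R) oU) fC).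
by move=> x _ /=; rewrite mulN1r.
Qed.

Lemma class_C_inv k U (f : 'rV[R]_n -> R) : open U ->
  (forall x, U x -> f x != 0) ->
  class_C k U f -> class_C k U (fun x => (f x)^-1).
Proof.
move=> oU f0; elim: k => [|k IH].
  by move=> fC x Ux; apply: continuousV; [exact: f0|exact: fC].
move=> fC; have Vk := IH (class_C_lower fC); case: fC => fd fk /=.
split=> [x Ux|v]; first by apply: differentiableV; [exact: fd|exact: f0].
apply: (class_C_ext oU)
  (class_C_opp oU (class_C_mul oU (fk v) (class_C_mul oU Vk Vk))) => x Ux /=.
rewrite [RHS]deriveV; [|exact: f0|by apply: diff_derivable; exact: fd].
by rewrite scaleNr -exprVn expr2 mulrC.
Qed.

Lemma class_C_sum k U (I : Type) (s : seq I) (P : pred I)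
    (F : I -> 'rV[R]_n -> R) : open U ->
  (forall i, P i -> class_C k U (F i)) ->
  class_C k U (fun x => \sum_(i <- s | P i) F i x).
Proof.
move=> oU FC; elim: s => [|i s IH].
  by apply: (class_C_ext oU) (class_C_cst k (0 : R) oU) => x _; rewrite big_nil.
case Pi : (P i); last first.
  by apply: (class_C_ext oU) IH => x _; rewrite big_cons Pi.
apply: (class_C_ext oU) (class_C_add oU (FC _ Pi) IH) => x _.
by rewrite big_cons Pi.
Qed.

Lemma differentiable_mx p q (F : 'rV[R]_n -> 'M[R]_(p, q)) x :
  (forall i j, differentiable (fun y => F y i j) x) -> differentiable F x.
Proof.
move=> dF.
have -> : F = \sum_i \sum_j (fun y => F y i j *: delta_mx i j).
  apply/funext => y; rewrite fct_sumE {1}(matrix_sum_delta (F y)).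
  by apply: eq_bigr => i _; rewrite fct_sumE.
apply: differentiable_sum => i; apply: differentiable_sum => j.
exact: differentiableZl.
Qed.

Lemma differentiable_entry p q (F : 'rV[R]_n -> 'M[R]_(p, q)) x i j :
  differentiable F x -> differentiable (fun y => F y i j) x.
Proof.
move=> dF.
exact: (@differentiable_comp R _ _ _ F (fun N : 'M[R]_(p, q) => N i j : R) x
   dF (differentiable_coord _ _ _)).
Qed.

Lemma derive_entry p q (F : 'rV[R]_n -> 'M[R]_(p, q)) x v i j :
  differentiable F x -> 'D_v F x i j = 'D_v (fun y => F y i j) x.
Proof. by move=> dF; rewrite derive_mx ?mxE //; exact: diff_derivable. Qed.

Lemma class_C_mx k U p q (F : 'rV[R]_n -> 'M[R]_(p, q)) : open U ->
  (forall i j, class_C k U (fun y => F y i j)) -> class_C k U F.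
Proof.
move=> oU; elim: k F => [|k IH] F FC.
  move=> x Ux; have : forall i j, {for x, continuous (fun y => F y i j)}.
    by move=> i j; exact: FC.
  move=> Fc.
  move=> A [B FB BA].
  have H i j : \forall y \near x, B i j (F y i j) := Fc i j _ (FB i j).
  have := filter_forall (nbhs_filter x) (fun i => filter_forall (nbhs_filter x) (H i)).
  by apply: filterS => y By; apply: BA.
have dF x : U x -> differentiable F x.
  by move=> Ux; apply: differentiable_mx => i j; case: (FC i j) => + _; exact.
split=> // v; apply: IH => i j; case: (FC i j) => _ /(_ v).
by apply: (class_C_ext oU) => x Ux; rewrite derive_entry //; exact: dF.
Qed.

Lemma class_C_entry k U p q (F : 'rV[R]_n -> 'M[R]_(p, q)) i j : open U ->
  class_C k U F -> class_C k U (fun y => F y i j).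
Proof.
move=> oU; elim: k F => [|k IH] F.
  move=> FC x Ux.
  apply: (@continuous_comp _ _ _ F (fun N : 'M[R]_(p, q) => N i j : R) x (FC x Ux)).
  exact: coord_continuous.
move=> [dF Fk]; split=> [x Ux|v]; first by apply/differentiable_entry/dF.
apply: (class_C_ext oU) (IH _ (Fk v)) => x Ux; rewrite derive_entry //; exact: dF.
Qed.

Lemma derive_scale (W : normedModType R) (f : 'rV[R]_n -> W) x (k : R) v :
  differentiable f x -> 'D_(k *: v) f x = k *: 'D_v f x.
Proof. by move=> df; rewrite !deriveE // linearZ. Qed.

Lemma derive_rowE (W : normedModType R) (f : 'rV[R]_n -> W) x v :
  differentiable f x ->
  'D_v f x = \sum_a v 0 a *: 'D_(delta_mx 0 a) f x.
Proof.
move=> df; rewrite deriveE // [in LHS](row_sum_delta v) linear_sum.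
by apply: eq_bigr => a _; rewrite linearZ deriveE.
Qed.

End ClassC.

Section Composition.
Variables (R : realType) (m n : nat).

Lemma derive_comp (W : normedModType R) (f : 'rV[R]_n -> W)
    (phi : 'rV[R]_m -> 'rV[R]_n) x v :
  differentiable phi x -> differentiable f (phi x) ->
  'D_v (f \o phi) x = 'D_('D_v phi x) f (phi x).
Proof.
move=> dphi df; rewrite !deriveE //; last exact: differentiable_comp.
by rewrite diff_comp.
Qed.

(** Induction on [k] through the chain rule
    D_v (f o phi) = sum_a (D_v phi)_a (D_a f o phi). *)
Lemma class_C_comp k (U : set 'rV[R]_n) (V : set 'rV[R]_m)
    (f : 'rV[R]_n -> R) (phi : 'rV[R]_m -> 'rV[R]_n) :
  open U -> open V -> (forall x, V x -> U (phi x)) ->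
  class_C k V phi -> class_C k U f -> class_C k V (f \o phi).
Proof.
move=> oU oV VU; elim: k f => [|k IH] f.
  move=> pC fC x Vx; apply: continuous_comp; first exact: pC.
  by apply: fC; exact: VU.
move=> pC; have pk := class_C_lower pC; case: pC => pd pk' [fd fk]; split.
  by move=> x Vx; apply: differentiable_comp; [exact: pd|apply/fd/VU].
move=> v.
have C a : class_C k V ((fun x => 'D_v phi x 0 a) \* ('D_(delta_mx 0 a) f \o phi)).
  apply: class_C_mul => //; first exact: (class_C_entry _ _ oV (pk' v)).
  exact: (IH _ pk (fk _)).
have S : class_C k V (fun x => \sum_a
    ((fun x => 'D_v phi x 0 a) \* ('D_(delta_mx 0 a) f \o phi)) x).
  by apply: class_C_sum => // a _; exact: C.
apply: (class_C_ext oV) S => x Vx /=.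
rewrite derive_comp; [|exact: pd|exact/fd/VU].
by rewrite [RHS]derive_rowE //; exact/fd/VU.
Qed.
End Composition.

(** * Symmetry of second derivatives *)

Section Clairaut.
Variables (R : realType) (n : nat).
Implicit Types (f : 'rV[R]_n -> R) (u v x : 'rV[R]_n).

Lemma is_derive_line f u a (s : R) :
  differentiable f (s *: u + a) ->
  is_derive s 1 (fun s => f (s *: u + a)) ('D_u f (s *: u + a)).
Proof.
move=> df.
have dl : is_derive s (1 : R) (fun s : R => s *: u + a) u.
  have d1 : is_derive s (1 : R) (fun s : R => s *: u) u.
    apply: DeriveDef.
      by apply/derivable1_diffP; exact: differentiableZl.
    rewrite deriveE; last exact: differentiableZl.
    by rewrite (diffZl u (@ex_diff _ _ _ _ _ _ _ (is_diff_id s))) /= diff_val scale1r.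
  have := is_deriveD d1 (is_derive_cst a s (1 : R)).
  by rewrite addr0.
have dl' : differentiable (fun s : R => s *: u + a) s.
  by apply/derivable1_diffP; exact: (@ex_derive _ _ _ _ _ _ _ dl).
have E : 'd (fun s : R => s *: u + a) s 1 = u.
  by rewrite -[LHS]deriveE //; exact: (@derive_val _ _ _ _ _ _ _ dl).
apply: DeriveDef.
  by apply/derivable1_diffP; exact: (differentiable_comp dl' df).
rewrite deriveE; last exact: (differentiable_comp dl' df).
by rewrite (diff_comp dl' df) /= E deriveE.
Qed.

Definition second_diff f u v x (t : R) : R :=
  f (t *: u + (t *: v + x)) - f (t *: u + x) - f (t *: v + x) + f x.

(** The mean value theorem along [u] writes the second difference as t times a
    difference of two values of D_u f, and differentiability of D_u f at [x]
    evaluates the latter. *)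
Lemma second_diff_approx f u v x (e : R) : 0 < e ->
  (\forall y \near x, differentiable f y) -> differentiable ('D_u f) x ->
  exists2 d : R, 0 < d & forall t, 0 < t -> t < d ->
    `|second_diff f u v x t / t ^+ 2 - 'D_v ('D_u f) x| <= e.
Proof.
move=> e0 df dg; set g := 'D_u f in dg *.
pose C := 2 * `|u| + `|v| + 1.
have C0 : 0 < C by rewrite ltr_wpDl // addr_ge0 // mulr_ge0.
have near0 : \forall h \near (0 : 'rV[R]_n), differentiable f (h + x) /\
    `|g (h + x) - g x - 'd g x h| <= e / C * `|h|.
  near=> h; split.
    near: h.
    have : \forall y \near x, differentiable f y by exact: df.
    by rewrite (near_shift 0) /= subr0.
  near: h.
  have [_ /eqaddoP] := (diff_locallyP _ _).1 dg.
  move=> /(_ (e / C)) /(_ (divr_gt0 e0 C0)); apply: filterS => h /=.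
  by rewrite !fctE /= opprD addrA.
have [d /= d0 dP] := (nbhs_normP _ _).1 near0.
have {}dP h : `|h| < d -> differentiable f (h + x) /\
    `|g (h + x) - g x - 'd g x h| <= e / C * `|h|.
  by move=> hd; apply: dP; rewrite /ball_ /= sub0r normrN.
exists (d / C); [exact: divr_gt0|move=> t t0].
rewrite ltr_pdivlMr // => td.
have small s : 0 <= s <= t ->
    `|s *: u| <= t * `|u| /\ `|s *: u + t *: v| <= t * `|u| + t * `|v|.
  move=> /andP[s0 st]; have su : `|s *: u| <= t * `|u|.
    by rewrite normrZ ger0_norm // ler_wpM2r.
  split=> //; apply: le_trans (ler_normD _ _) _; rewrite lerD //.
  by rewrite normrZ gtr0_norm.
have tC : t * `|u| + t * `|v| < d.
  apply: le_lt_trans td; rewrite -mulrDr ler_wpM2l ?ltW // /C.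
  have := normr_ge0 u; lra.
have tC' : t * `|u| < d.
  by apply: le_lt_trans tC; rewrite lerDl mulr_ge0 // ltW.
pose phi s := f (s *: u + (t *: v + x)) - f (s *: u + x).
have dphi s : 0 <= s <= t ->
    is_derive s 1 phi (g (s *: u + (t *: v + x)) - g (s *: u + x)).
  move=> st; have [s1 s2] := small s st; apply: is_deriveB.
    apply: is_derive_line; rewrite addrA.
    by apply: (dP _ _).1; exact: le_lt_trans tC.
  by apply: is_derive_line; apply: (dP _ _).1; exact: le_lt_trans tC'.
have cphi : {within `[0, t], continuous phi}.
  apply: derivable_within_continuous => s; rewrite in_itv /= => st.
  exact: (@ex_derive _ _ _ _ _ _ _ (dphi s st)).
have dphi' s : s \in `]0, t[ ->
    is_derive s 1 phi (g (s *: u + (t *: v + x)) - g (s *: u + x)).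
  by rewrite in_itv /= => /andP[/ltW s0 /ltW st]; apply: dphi; rewrite s0.
have [s] := MVT t0 dphi' cphi; rewrite in_itv /= => /andP[/ltW s0 /ltW st].
have {}st : 0 <= s <= t by rewrite s0.
have -> : phi t - phi 0 = second_diff f u v x t.
  by rewrite /phi /second_diff scale0r !add0r; ring.
rewrite subr0 => ->; have [s1 s2] := small s st.
have [_ e1] := dP _ (le_lt_trans s2 tC); have [_ e2] := dP _ (le_lt_trans s1 tC').
rewrite deriveE // (addrA (s *: u)).
rewrite linearD ['d g x (t *: v)]linearZ /= in e1.
set a := g _ in e1 *; set b := g _ in e2 *.
set p := 'd g x (s *: u) in e1 e2; set q := 'd g x v in e1 *.
have -> : (a - b) * t / t ^+ 2 - q = ((a - g x - (p + t *: q)) - (b - g x - p)) / t.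
  by rewrite /GRing.scale /=; field; rewrite gt_eqF.
rewrite normrM normfV (gtr0_norm t0) ler_pdivrMr //.
apply: le_trans (ler_normB _ _) _.
set N1 : R := `|s *: u + t *: v| in e1 s2; set N2 : R := `|s *: u| in e2 s1.
apply: (@le_trans _ _ (e / C * N1 + e / C * N2)); first exact: lerD e1 e2.
have NC : N1 + N2 <= C * t.
  by have := mulr_ge0 (ltW t0) (normr_ge0 u); rewrite /C; nra.
rewrite -mulrDr mulrAC ler_pdivrMr // -mulrA.
by rewrite ler_wpM2l ?(ltW e0) // (mulrC t).
Unshelve. all: by end_near. Qed.

Lemma norm_sub_halves (z a b e : R) :
  `|z - a| <= e / 2 -> `|z - b| <= e / 2 -> `|a - b| <= e.
Proof.
move=> za zb; have -> : a - b = (z - b) - (z - a) by ring.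
by rewrite (le_trans (ler_normB _ _)) // [e]splitr lerD.
Qed.

(** The second difference is symmetric in [u] and [v] and approximates both mixed
    derivatives. *)
Lemma derive_symmetric f u v (U : set 'rV[R]_n) x : open U -> U x ->
  class_C 2 U f -> 'D_u ('D_v f) x = 'D_v ('D_u f) x.
Proof.
move=> oU Ux [fd f2].
have df : \forall y \near x, differentiable f y by exact: (open_near oU).
have d2 w : differentiable ('D_w f) x by case: (f2 w) => + _; exact.
apply/eqP; rewrite -subr_eq0 -normr_eq0 eq_le normr_ge0 andbT.
apply/ler_addgt0Pr => e e0; rewrite add0r.
have e2 : 0 < e / 2 by rewrite divr_gt0.
have [d1 d10 H1] := second_diff_approx u e2 df (d2 v).
have [d2' d20 H2] := second_diff_approx v e2 df (d2 u).
pose t := Num.min d1 d2' / 2.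
have m0 : 0 < Num.min d1 d2' by rewrite lt_min d10.
have t0 : 0 < t by rewrite divr_gt0.
have [t1 t2] : t < d1 /\ t < d2'.
  by apply/andP; rewrite -lt_min /t; lra.
have {H1}h1 := H1 t t0 t1; have {H2}h2 := H2 t t0 t2.
have E : second_diff f v u x t = second_diff f u v x t.
  by rewrite /second_diff !addrA (addrC (t *: v)); ring.
rewrite E in h1; exact: norm_sub_halves h1 h2.
Qed.
End Clairaut.

(** * Smooth plateau functions *)

Section Flat.
Variable R : realType.
Implicit Types (P : {poly R}) (t : R).

(** Multiples of exp(-1/t), extended by 0 for t <= 0, with coefficient a
    polynomial in 1/t: this family is closed under derivation. *)
Definition flat P t : R := if 0 < t then P.[t^-1] * expR (- t^-1) else 0.

(** exp(1/t) dominates every power of 1/t. *)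
Lemma flat_bound P : exists C : R, forall t, t <= 1 -> `|flat P t| <= C * t ^+ 2.
Proof.
pose N := size P; pose S := \sum_(i < N) `|P`_i|.
have S0 : 0 <= S by apply: sumr_ge0.
have F0 : 0 <= S * (N.+2)`!%:R :> R by rewrite mulr_ge0.
exists (S * (N.+2)`!%:R) => t t1; rewrite /flat; case: ifPn => [t0|_]; last first.
  by rewrite normr0 mulr_ge0 // sqr_ge0.
set s := t^-1.
have s1 : 1 <= s by rewrite invf_ge1.
have s0 : 0 < s by rewrite invr_gt0.
have PS : `|P.[s]| <= S * s ^+ N.
  rewrite horner_coef (le_trans (ler_norm_sum _ _ _)) // mulr_suml ler_sum // => i _.
  rewrite normrM ler_wpM2l // normrX gtr0_norm // ler_weXn2l // ltnW //.
have Es : s ^+ N.+2 * expR (- s) <= (N.+2)`!%:R.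
  rewrite expRN ler_pdivrMr ?expR_gt0 // mulrC -ler_pdivrMr ?ltr0n ?fact_gt0 //.
  apply: le_trans (expR_ge1Dxn N.+1 (ltW s0)); rewrite lerDr //.
rewrite normrM (ger0_norm (expR_ge0 _)).
apply: (@le_trans _ _ (S * s ^+ N * expR (- s))).
  by rewrite ler_wpM2r // expR_ge0.
have -> : S * s ^+ N * expR (- s) = S * (s ^+ N.+2 * expR (- s)) * t ^+ 2.
  have st : s * t = 1 by rewrite mulVf // gt_eqF.
  rewrite -addn2 exprD.
  transitivity (S * s ^+ N * expR (- s) * (s * t) ^+ 2); last by ring.
  by rewrite st expr1n mulr1.
by rewrite ler_wpM2r ?sqr_ge0 // ler_wpM2l.
Qed.

(** From (P(1/t) exp(-1/t))' = t^-2 (P - P')(1/t) exp(-1/t). *)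
Definition flat_deriv P := 'X^2 * (P - P^`()).

(** Used at t = 0, where [flat P] has no closed formula on a neighbourhood. *)
Lemma quadratic_is_derive0 (F : R -> R) (C : R) :
  (forall t, t <= 1 -> `|F t| <= C * t ^+ 2) -> is_derive (0 : R) (1 : R) F 0.
Proof.
move=> FC.
have F0 : F 0 = 0.
  by apply/eqP; rewrite -normr_le0 (le_trans (FC 0 ler01)) // expr0n mulr0.
have C0 : 0 <= C by have := FC 1 (lexx _); rewrite expr1n mulr1; exact: le_trans.
have cv : h^-1 *: (F (h *: 1 + 0) - F 0) @[h --> 0^'] --> (0 : R).
  apply/cvgrPdist_le => /= e e0; near=> h.
  have h0 : h != 0 by near: h; exact: nbhs_dnbhs_neq.
  have h1 : `|h| <= 1.
    by near: h; apply: dnbhs0_le.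
  have he : `|h| <= e / (C + 1).
    by near: h; apply: dnbhs0_le; rewrite divr_gt0 // ltr_wpDl.
  rewrite sub0r normrN addr0 F0 subr0 [h *: 1]mulr1 normrM normfV.
  rewrite ler_pdivrMl ?normr_gt0 //.
  apply: (le_trans (FC _ (le_trans (ler_norm _) h1))).
  rewrite -[h ^+ 2]ger0_norm ?sqr_ge0 // normrX expr2 mulrCA ler_wpM2l //.
  rewrite ler_pdivlMr in he; last by rewrite ltr_wpDl.
  by have := normr_ge0 h; nra.
apply: DeriveDef; first by apply/cvg_ex; exists 0.
exact/cvg_lim.
Unshelve. all: by end_near. Qed.

Lemma is_derive_flat P t : is_derive t (1 : R) (flat P) (flat (flat_deriv P) t).
Proof.
have [t0|t0|->] := ltgtP t 0.
- have E : \forall s \near t, cst 0 s = flat P s.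
    near=> s; rewrite /flat; have -> // : (0 < s) = false.
    apply/negbTE; rewrite -leNgt ltW //; near: s; exact: lt_nbhsl.
  apply: near_eq_is_derive E _; rewrite /flat ltNge (ltW t0) /=.
  exact: is_derive_cst.
- have E : \forall s \near t, (fun s => P.[s^-1] * expR (- s^-1)) s = flat P s.
    by near=> s; rewrite /flat; have -> : 0 < s by near: s; exact: lt_nbhsr.
  apply: near_eq_is_derive E _.
  have tn : t != 0 by rewrite gt_eqF.
  have dV : is_derive t (1 : R) (fun s : R => s^-1) (- t ^- 2).
    have := @is_deriveV R id t 1 1 tn (is_derive_id t 1).
    by rewrite [_ *: _]mulr1.
  have dE : is_derive t (1 : R) (fun s : R => expR (- s^-1)) (t ^- 2 * expR (- t^-1)).
    have := @is_derive1_comp R expR (fun s => - s^-1) t _ _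
      (is_derive_expR _) (is_deriveN dV).
    by rewrite opprK mulrC.
  have dP : is_derive t (1 : R) (fun s : R => P.[s^-1]) (P^`().[t^-1] * - t ^- 2).
    exact: (@is_derive1_comp R (horner P) (fun s => s^-1) t _ _
      (is_derive_poly P _) dV).
  apply: is_derive_eq (is_deriveM dP dE) _.
  rewrite /flat t0 /flat_deriv !hornerE /= /GRing.scale /=.
  rewrite -exprVn; ring.
- have [C PC] := flat_bound P.
  by have := quadratic_is_derive0 PC; rewrite {3}/flat ltxx.
Unshelve. all: by end_near. Qed.

Lemma flat1_gt0 t : 0 < t -> 0 < flat 1 t.
Proof. by move=> t0; rewrite /flat t0 hornerE mul1r expR_gt0. Qed.

Lemma flat_le0 P t : t <= 0 -> flat P t = 0.
Proof. by move=> t0; rewrite /flat ltNge t0. Qed.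

Lemma flat1_ge0 t : 0 <= flat 1 t.
Proof. by case: (ltP 0 t) => [/flat1_gt0/ltW//|/flat_le0 ->]. Qed.

Lemma class_C_flat n k (U : set 'rV[R]_n) P (q : 'rV[R]_n -> R) : open U ->
  class_C k U q -> class_C k U (flat P \o q).
Proof.
move=> oU; elim: k P => [|k IH] P.
  move=> qC x Ux; apply: continuous_comp; first exact: qC.
  apply/differentiable_continuous/derivable1_diffP.
  exact: (@ex_derive _ _ _ _ _ _ _ (is_derive_flat P _)).
move=> qC; have qk := class_C_lower qC; case: qC => qd qk'.
have dF t : differentiable (flat P) t.
  apply/derivable1_diffP; exact: (@ex_derive _ _ _ _ _ _ _ (is_derive_flat P _)).
split=> [x Ux|v]; first by apply: differentiable_comp => //; exact: qd.
apply: (class_C_ext oU) (class_C_mul oU (IH (flat_deriv P) qk) (qk' v)) => x Ux /=.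
rewrite [RHS]deriveE; last by apply: differentiable_comp => //; exact: qd.
rewrite diff_comp //; last exact: qd.
rewrite /= -(deriveE v (qd x Ux)).
rewrite -['D_v q x in RHS]mulr1 [RHS]linearZ /=.
have Ed : 'd (flat P) (q x) 1 = flat (flat_deriv P) (q x).
  rewrite -[LHS]deriveE //.
  exact: (@derive_val _ _ _ _ _ _ _ (is_derive_flat P (q x))).
by rewrite Ed mulrC.
Qed.
End Flat.

Section Plateau.
Variables (R : realType) (n : nat).

Let sqd (p y : 'rV[R]_n) : R := \sum_k (y 0 k - p 0 k) * (y 0 k - p 0 k).

Let sqd_smooth p : smooth_on setT (sqd p).
Proof.
move=> k; have oT : open [set: 'rV[R]_n] by exact: openT.
have coordC (j : 'I_n) : class_C k setT (fun y : 'rV[R]_n => y 0 j).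
  apply: class_C_entry => //; case: k => [|k]; first by move=> x _; exact: cvg_id.
  split=> [x _|v]; first exact: ex_diff.
  by apply: (class_C_ext oT) (class_C_cst k v oT) => x _; rewrite derive_id.
have dC (j : 'I_n) : class_C k setT (fun y : 'rV[R]_n => y 0 j - p 0 j).
  exact: class_C_add oT (coordC j) (class_C_cst k (- p 0 j : R) oT).
by apply: class_C_sum => // j _; exact: class_C_mul.
Qed.

Let sqd_ball p y (e : R) : 0 < e -> sqd p y < e ^+ 2 -> `|y - p| < e.
Proof.
move=> e0 ye; rewrite /Num.norm /= mx_normrE; apply: bigmax_lt => //= -[i j] _ /=.
rewrite ord1 mxE mxE -(@ltr_pXn2r _ 2) // ?nnegrE ?ltW //.
apply: le_lt_trans ye; rewrite /sqd (bigD1 j) //= -expr2 real_normK ?num_real //.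
by rewrite lerDl sumr_ge0 // => k _; rewrite -expr2 sqr_ge0.
Qed.

(** The quotient A / (A + B), where A is positive for |y - p|^2 < 2 d and B for
    |y - p|^2 > d, both flat elsewhere. *)
Lemma plateau (p : 'rV[R]_n) (U : set 'rV[R]_n) : open U -> U p ->
  exists chi : 'rV[R]_n -> R, [/\ smooth_on setT chi, (\near p, chi p = 1) &
    exists2 K, compact K /\ K `<=` U & forall y, ~ K y -> chi y = 0].
Proof.
move=> oU Up; have oT : open [set: 'rV[R]_n] by exact: openT.
have /nbhs_normP[e /= e0 eU] : nbhs p U by apply: open_nbhs_nbhs.
pose d := e ^+ 2 / 4.
have e20 : 0 < e ^+ 2 by rewrite exprn_gt0.
have d0 : 0 < d by rewrite divr_gt0.
pose A := flat 1 \o (fun y => 2 * d - sqd p y).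
pose B := flat 1 \o (fun y => sqd p y - d).
have As k : class_C k setT A.
  apply: class_C_flat => //; apply: (class_C_add oT (class_C_cst k (2 * d : R) oT)).
  exact: (class_C_opp oT (sqd_smooth p k)).
have Bs k : class_C k setT B.
  apply: class_C_flat => //.
  exact: (class_C_add oT (sqd_smooth p k) (class_C_cst k (- d : R) oT)).
have AB0 y : A y + B y != 0.
  rewrite gt_eqF //; case: (ltP (sqd p y) (2 * d)) => h.
    by rewrite ltr_wpDr ?flat1_ge0 //; apply: flat1_gt0; rewrite subr_gt0.
  rewrite ltr_wpDl ?flat1_ge0 //; apply: flat1_gt0; rewrite subr_gt0.
  by apply: lt_le_trans h; lra.
exists (A \* (fun y => (A y + B y)^-1)); split.
- move=> k; apply: class_C_mul => //; apply: class_C_inv => //.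
  exact: class_C_add.
- have cs : {for p, continuous (sqd p)} by exact: class_C_continuous (sqd_smooth p 0) _.
  have s0 : sqd p p = 0 by rewrite /sqd big1 // => k _; rewrite subrr mul0r.
  have : \forall y \near p, sqd p y < d.
    by apply: (cs [set r | r < d]); rewrite s0; exact: lt_nbhsl.
  apply: filterS => y yd /=.
  have By : B y = 0 by rewrite /B /= flat_le0 // subr_le0 ltW.
  by have := AB0 y; rewrite By addr0 => /mulfV.
- exists [set y | sqd p y <= 2 * d]; last first.
    move=> y /= /negP; rewrite -ltNge => yd.
    by rewrite /A /= flat_le0 ?mul0r // subr_le0 ltW.
  have Kb y : sqd p y <= 2 * d -> `|y - p| < e.
    by move=> yd; apply: sqd_ball => //; apply: le_lt_trans yd _; rewrite /d; lra.
  split; last by move=> y /Kb yp; apply: eU; rewrite /ball_ /= distrC.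
  apply: bounded_closed_compact.
    exists (`|p| + e); split; first exact: num_real.
    move=> M hM y /Kb yp; apply: ltW; apply: le_lt_trans hM.
    by rewrite -[y](subrK p) (le_trans (ler_normD _ _)) // addrC lerD // ltW.
  apply: (@closed_comp _ _ (sqd p) [set r | r <= 2 * d]).
    by move=> y _; exact: class_C_continuous (sqd_smooth p 0) _.
  exact: closed_le.
Qed.
End Plateau.

(** * The ring of smooth functions on an open set *)

(** Functions are normalised to 0 outside [U], so that functions equal on [U]
    are equal. The openness proof is a parameter because the ring structure
    depends on it. *)
Record smooth_fun (R : realType) (n : nat) (U : set 'rV[R]_n) (oU : open U) :=
  SmoothFun {
    sf_val :> 'rV[R]_n -> R;
    sf_smooth : smooth_on U sf_val;
    sf_out : forall x, ~ U x -> sf_val x = 0 }.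

Section SmoothRing.
Variables (R : realType) (n : nat) (U : set 'rV[R]_n) (oU : open U).

Local Notation A := (smooth_fun oU).

HB.instance Definition _ := gen_eqMixin A.
HB.instance Definition _ := gen_choiceMixin A.

Lemma sf_eq (f g : A) : (forall x, U x -> f x = g x) -> f = g.
Proof.
move=> fg; have : sf_val f = sf_val g.
  apply/funext => x; have [/fg //|nU] := pselect (U x).
  by rewrite !sf_out.
case: f g {fg} => [f fs fo] [g gs go] /= E; rewrite -E in gs go *.
by congr SmoothFun; exact: Prop_irrelevance.
Qed.

Lemma restr_smooth (f : 'rV[R]_n -> R) :
  smooth_on U f -> smooth_on U (fun x => if `[< U x >] then f x else 0).
Proof. by move=> fs k; apply: (class_C_ext oU) (fs k) => x Ux; rewrite asboolT. Qed.

Lemma restr_out (f : 'rV[R]_n -> R) x :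
  ~ U x -> (if `[< U x >] then f x else 0) = 0.
Proof. by move=> nU; rewrite asboolF. Qed.

Definition restr (f : 'rV[R]_n -> R) (fs : smooth_on U f) : A :=
  SmoothFun oU (restr_smooth fs) (@restr_out f).

Lemma restrE f (fs : smooth_on U f) x : U x -> restr fs x = f x.
Proof. by move=> Ux; rewrite /= asboolT. Qed.

Lemma smooth_onD (f g : 'rV[R]_n -> R) :
  smooth_on U f -> smooth_on U g -> smooth_on U (f \+ g).
Proof. by move=> fs gs k; apply: class_C_add. Qed.
Lemma smooth_onM (f g : 'rV[R]_n -> R) :
  smooth_on U f -> smooth_on U g -> smooth_on U (f \* g).
Proof. by move=> fs gs k; apply: class_C_mul. Qed.
Lemma smooth_onN (f : 'rV[R]_n -> R) : smooth_on U f -> smooth_on U (\- f).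
Proof. by move=> fs k; apply: class_C_opp. Qed.
Lemma smooth_on_cst (a : R) : smooth_on U (cst a).
Proof. by move=> k; apply: class_C_cst. Qed.
Lemma smooth_on_derive (f : 'rV[R]_n -> R) v :
  smooth_on U f -> smooth_on U ('D_v f).
Proof. by move=> fs k; case: (fs k.+1) => _; exact. Qed.
Lemma smooth_on_diff (W : normedModType R) (f : 'rV[R]_n -> W) x :
  smooth_on U f -> U x -> differentiable f x.
Proof. by move=> fs; case: (fs 1%N) => + _; exact. Qed.

Definition sf_add (f g : A) : A :=
  restr (smooth_onD (@sf_smooth _ _ _ _ f) (@sf_smooth _ _ _ _ g)).
Definition sf_mul (f g : A) : A :=
  restr (smooth_onM (@sf_smooth _ _ _ _ f) (@sf_smooth _ _ _ _ g)).
Definition sf_opp (f : A) : A := restr (smooth_onN (@sf_smooth _ _ _ _ f)).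
Definition sf_cst (a : R) : A := restr (smooth_on_cst a).

Let sf_addA : associative sf_add.
Proof. by move=> f g h; apply: sf_eq => x Ux; rewrite !restrE /= ?asboolT // addrA. Qed.
Let sf_addC : commutative sf_add.
Proof. by move=> f g; apply: sf_eq => x Ux; rewrite !restrE /= ?asboolT // addrC. Qed.
Let sf_add0 : left_id (sf_cst 0) sf_add.
Proof. by move=> f; apply: sf_eq => x Ux; rewrite !restrE /= ?asboolT // add0r. Qed.
Let sf_addN : left_inverse (sf_cst 0) sf_opp sf_add.
Proof. by move=> f; apply: sf_eq => x Ux; rewrite !restrE /= ?asboolT // addNr. Qed.

HB.instance Definition _ := GRing.isZmodule.Build A sf_addA sf_addC sf_add0 sf_addN.

Let sf_mulA : associative sf_mul.
Proof. by move=> f g h; apply: sf_eq => x Ux; rewrite !restrE /= ?asboolT // mulrA. Qed.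
Let sf_mulC : commutative sf_mul.
Proof. by move=> f g; apply: sf_eq => x Ux; rewrite !restrE /= ?asboolT // mulrC. Qed.
Let sf_mul1 : left_id (sf_cst 1) sf_mul.
Proof. by move=> f; apply: sf_eq => x Ux; rewrite !restrE /= ?asboolT // mul1r. Qed.
Let sf_mulD : left_distributive sf_mul +%R.
Proof.
by move=> f g h; apply: sf_eq => x Ux; rewrite !restrE /= ?asboolT // mulrDl.
Qed.

HB.instance Definition _ :=
  GRing.Zmodule_isComPzRing.Build A sf_mulA sf_mulC sf_mul1 sf_mulD.

Definition ev (x : 'rV[R]_n) (f : A) : R := f x.

Arguments ev : simpl never.

Lemma evD x : {morph ev x : f g / f + g}.
Proof.
move=> f g; rewrite /ev; have [Ux|nU] := pselect (U x); first by rewrite /= asboolT.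
by rewrite !sf_out // addr0.
Qed.
Lemma evN x : {morph ev x : f / - f}.
Proof.
move=> f; rewrite /ev; have [Ux|nU] := pselect (U x); first by rewrite /= asboolT.
by rewrite !sf_out // oppr0.
Qed.
Lemma evB x : {morph ev x : f g / f - g}.
Proof. by move=> f g; rewrite evD evN. Qed.
HB.instance Definition _ x := GRing.isZmodMorphism.Build A R (ev x) (evB x).
Lemma evM x : {morph ev x : f g / f * g}.
Proof.
move=> f g; rewrite /ev; have [Ux|nU] := pselect (U x); first by rewrite /= asboolT.
by rewrite !sf_out // mulr0.
Qed.
Lemma evMn x f m : ev x (f *+ m) = ev x f *+ m.
Proof. exact: raddfMn. Qed.
Lemma ev1 x : U x -> ev x 1 = 1.
Proof. by move=> Ux; rewrite /ev /= asboolT. Qed.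
Lemma ev_nat x m : U x -> ev x m%:R = m%:R.
Proof. by move=> Ux; rewrite -[RHS]/(1 *+ m) -(ev1 Ux); exact: raddfMn. Qed.

Definition sder (a : 'I_n) (f : A) : A :=
  restr (smooth_on_derive (delta_mx 0 a) (@sf_smooth _ _ _ _ f)).

Lemma ev_sder x a f : U x -> ev x (sder a f) = 'D_(delta_mx 0 a) f x.
Proof. by move=> Ux; rewrite /ev restrE. Qed.

Lemma ev_inj (f g : A) : (forall x, U x -> ev x f = ev x g) -> f = g.
Proof. exact: sf_eq. Qed.

Lemma derive_sf_ext x v (f : A) (g : 'rV[R]_n -> R) : U x ->
  (forall y, U y -> f y = g y) -> 'D_v f x = 'D_v g x.
Proof. by move=> Ux fg; apply: near_eq_derive; exact: (open_near oU). Qed.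

Lemma sder_additive a : {morph sder a : f g / f - g}.
Proof.
move=> f g; apply: ev_inj => x Ux.
have df (h : A) : derivable h x (delta_mx 0 a).
  exact/diff_derivable/(smooth_on_diff (@sf_smooth _ _ _ _ h)).
rewrite evB !ev_sder // -deriveB //; apply: derive_sf_ext => // y Uy.
by rewrite -[LHS]/(ev y (f - g)) evB.
Qed.
HB.instance Definition _ a := GRing.isZmodMorphism.Build A A (sder a) (sder_additive a).

Lemma sderM a (f g : A) : sder a (f * g) = sder a f * g + f * sder a g.
Proof.
apply: ev_inj => x Ux.
have df (h : A) : derivable h x (delta_mx 0 a).
  exact/diff_derivable/(smooth_on_diff (@sf_smooth _ _ _ _ h)).
rewrite evD !evM !ev_sder // addrC [X in _ + X]mulrC.
rewrite -[RHS](deriveM (df f) (df g)); apply: derive_sf_ext => // y Uy.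
by rewrite -[LHS]/(ev y (f * g)) evM.
Qed.

Lemma sderC a b (f : A) : sder a (sder b f) = sder b (sder a f).
Proof.
apply: ev_inj => x Ux.
transitivity ('D_(delta_mx 0 a) (sder b f) x); first exact: ev_sder.
transitivity ('D_(delta_mx 0 b) (sder a f) x); last by apply/esym; exact: ev_sder.
have E c : forall y, U y -> (sder c f) y = 'D_(delta_mx 0 c) f y.
  by move=> y Uy; rewrite -[LHS]/(ev y _) ev_sder.
transitivity ('D_(delta_mx 0 a) ('D_(delta_mx 0 b) f) x).
  exact: (derive_sf_ext _ Ux (E b)).
transitivity ('D_(delta_mx 0 b) ('D_(delta_mx 0 a) f) x).
  exact: (derive_symmetric _ _ oU Ux (@sf_smooth _ _ _ _ f 2)).
by apply/esym; exact: (derive_sf_ext _ Ux (E a)).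
Qed.

Lemma sf_torsion_free m (f : A) : f *+ m.+1 = 0 -> f = 0.
Proof.
move=> f0; apply: ev_inj => x Ux; have := congr1 (ev x) f0.
rewrite !raddfMn !raddf0 /= => /eqP; by rewrite mulrn_eq0 /= => /eqP ->.
Qed.

Lemma ev_sum x (I : finType) (F : I -> A) : ev x (\sum_i F i) = \sum_i ev x (F i).
Proof. exact: raddf_sum. Qed.

Definition evm x p q (M : 'M[A]_(p, q)) : 'M[R]_(p, q) := map_mx (ev x) M.

Lemma evmE x p q (M : 'M[A]_(p, q)) i j : evm x M i j = ev x (M i j).
Proof. exact: mxE. Qed.

Lemma evmM x p q r (M : 'M[A]_(p, q)) (N : 'M[A]_(q, r)) :
  evm x (M *m N) = evm x M *m evm x N.
Proof.
apply/matrixP => i j; rewrite !mxE ev_sum; apply: eq_bigr => k _.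
by rewrite evM !mxE.
Qed.

Lemma evm_inj p q (M N : 'M[A]_(p, q)) :
  (forall x, U x -> evm x M = evm x N) -> M = N.
Proof.
move=> MN; apply/matrixP => i j; apply: ev_inj => x Ux.
by have /matrixP/(_ i j) := MN x Ux; rewrite !mxE.
Qed.

(** Locked so that entries are only read through [evm_restr]. *)
Definition restr_mx p q (F : 'rV[R]_n -> 'M[R]_(p, q)) (Fs : smooth_on U F) :
    'M[A]_(p, q) :=
  locked (\matrix_(i, j) restr (fun k => class_C_entry i j oU (Fs k))).

Lemma evm_restr p q (F : 'rV[R]_n -> 'M[R]_(p, q)) (Fs : smooth_on U F) x :
  U x -> evm x (restr_mx Fs) = F x.
Proof.
move=> Ux; rewrite /restr_mx -lock.
by apply/matrixP => i j; rewrite !mxE /ev restrE.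
Qed.

End SmoothRing.

(** * Extending constant fields from a chart to the manifold *)

Section Extension.
Variables (R : realType) (n : nat) (M : manifold R n).
Implicit Types (a b c i j : chart_index M).

Local Notation tau a b := (transition (atlas a) (atlas b)).
Local Notation ovl a b := (overlap (atlas a) (atlas b)).

Lemma open_overlap a b : open (ovl a b).
Proof.
rewrite openE => x [cx dx]; apply: filterI.
  by apply: open_nbhs_nbhs; split=> //; exact: cod_open.
by apply: (param_continuous cx); apply: open_nbhs_nbhs; split=> //; exact: dom_open.
Qed.

Arguments open_overlap : clear implicits.

Lemma overlap_transition a b x : ovl a b x -> ovl b a (tau a b x).
Proof.
move=> [cx dx]; split; first exact: coords_cod.
by rewrite /transition /= coordsK //; exact: param_dom.
Qed.

Lemma param_transition a b x : ovl a b x ->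
  param (atlas b) (tau a b x) = param (atlas a) x.
Proof. by move=> [cx dx]; rewrite /transition /= coordsK. Qed.

Lemma transition_comp a b c x : ovl a b x -> tau b c (tau a b x) = tau a c x.
Proof.
by move=> abx; rewrite /transition /= -[RHS](congr1 _ (param_transition abx)).
Qed.

Lemma transition_id a x : cod (atlas a) x -> tau a a x = x.
Proof. by move=> cx; rewrite /transition /= paramK. Qed.

Lemma transition_diff a b x : ovl a b x -> differentiable (tau a b) x.
Proof. by move=> abx; case: (atlas_smooth a b 1%N) => + _; exact. Qed.

(** The connection and the hypotheses on it are only given on global vector
    fields; this lemma makes them available on constant local fields. The field
    is cut off by a plateau function with compact support [K] in the chart and
    vanishes off the image of [K], which is closed because the manifold is
    Hausdorff. *)
Lemma extend_const i (p v : 'rV[R]_n) : cod (atlas i) p ->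
  exists X : vector_field M, \forall y \near p, X i y = v.
Proof.
move=> cp.
have [chi [chi_s chi1 [K [cK KU] chi0]]] :=
  plateau (@cod_open _ _ _ (atlas i)) cp.
pose X j y := if `[< dom (atlas i) (param (atlas j) y) >]
  then chi (tau j i y) *: 'D_v (tau i j) (tau j i y) else 0.
have X_in j y : dom (atlas i) (param (atlas j) y) ->
    X j y = chi (tau j i y) *: 'D_v (tau i j) (tau j i y).
  by move=> dy; rewrite /X asboolT.
have closedK : closed (param (atlas i) @` K).
  apply: compact_closed; first exact: carrier_hausdorff.
  apply: continuous_compact => //; apply: continuous_in_subspaceT => x.
  by rewrite inE => /KU; exact: param_continuous.
have Xs j : smooth_on (cod (atlas j)) (X j).
  move=> k; apply: class_C_local => y cy.
  have [dy|ndy] := pselect (dom (atlas i) (param (atlas j) y)).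
    exists (ovl j i) => //; have oji := open_overlap j i.
    apply: (class_C_ext oji
      (f := fun z => chi (tau j i z) *: 'D_v (tau i j) (tau j i z))).
      by move=> z [_ dz]; rewrite X_in.
    apply: class_C_mx => // e l.
    have C1 : class_C k (ovl j i) (chi \o tau j i).
      apply: (class_C_comp openT oji _ (atlas_smooth j i k) (chi_s k)) => //.
    have C2 : class_C k (ovl j i) ((fun z => 'D_v (tau i j) z e l) \o tau j i).
      apply: (class_C_comp (open_overlap i j) oji _ (atlas_smooth j i k)).
        by move=> z; exact: overlap_transition.
      apply: class_C_entry; first exact: open_overlap.
      by case: (atlas_smooth i j k.+1) => _; exact.
    apply: (class_C_ext oji) (class_C_mul oji C1 C2) => z _.
    by rewrite /= mxE.
  pose V := cod (atlas j) `&` param (atlas j) @^-1` (~` (param (atlas i) @` K)).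
  have oV : open V.
    rewrite openE => z [cz nz]; apply: filterI.
      by apply: open_nbhs_nbhs; split=> //; exact: cod_open.
    apply: (param_continuous cz); apply: open_nbhs_nbhs; split=> //.
    exact: closed_openC.
  exists V.
    split=> // -[z Kz zy]; apply: ndy; rewrite -zy.
    by apply: param_dom; exact: KU.
  apply: (class_C_ext oV) (class_C_cst k 0 oV) => z [cz nz] /=.
  rewrite /X; case: asboolP => // dz; rewrite chi0 ?scale0r // => Kz.
  by apply: nz; exists (tau j i z) => //; exact: param_transition.
have Xt a b x : ovl a b x -> X b (tau a b x) = 'D_(X a x) (tau a b) x.
  move=> abx; rewrite {1}/X param_transition //.
  have [dx|ndx] := asboolP (dom (atlas i) (param (atlas a) x)); last first.
    by rewrite /X asboolF // derive0.
  have aix : ovl a i x by case: abx.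
  have iax := overlap_transition aix.
  rewrite transition_comp // X_in //.
  have dab := transition_diff abx.
  rewrite [RHS](derive_scale _ _ dab); apply: (congr1 (GRing.scale _)).
  have zx : tau i a (tau a i x) = x.
    by rewrite transition_comp // transition_id //; case: abx.
  transitivity ('D_v (tau a b \o tau i a) (tau a i x)); last first.
    by rewrite derive_comp ?zx //; exact: transition_diff.
  apply: near_eq_derive; apply: (open_near (open_overlap i a) iax) => z iaz /=.
  by rewrite transition_comp.
exists (VectorField (conj Xs Xt)) => /=.
have cn : \forall y \near p, cod (atlas i) y.
  by apply: open_nbhs_nbhs; split=> //; exact: cod_open.
near=> y; have cy : cod (atlas i) y by near: y.
rewrite X_in; last exact: param_dom.
have -> : chi (tau i i y) = 1 by rewrite transition_id //; near: y.
rewrite scale1r transition_id //.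
rewrite (near_eq_derive (g := id)) ?derive_id //.
by apply: (open_near (@cod_open _ _ _ _) cy) => z; exact: transition_id.
Unshelve. all: by end_near. Qed.
End Extension.

(** * The geometric hypotheses in one chart *)

(** The operators of this part depend on germs only; their congruence lemmas are
    composed with this one. *)
Lemma sub2_eq (V : zmodType) (a a' b b' c c' : V) :
  a = a' -> b = b' -> c = c' -> a - b - c = a' - b' - c'.
Proof. by move=> -> -> ->. Qed.

Section Locality.
Variables (R : realType) (n : nat) (V : set 'rV[R]_n) (oV : open V).
Variables (Gamma : 'I_n -> 'rV[R]_n -> 'M[R]_n).
Implicit Types X Y Z : 'rV[R]_n -> 'rV[R]_n.

Lemma derive_agree (W : normedModType R) (f h : 'rV[R]_n -> W) v x :
  (forall y, V y -> f y = h y) -> V x -> 'D_v f x = 'D_v h x.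
Proof. by move=> fh Vx; apply: near_eq_derive; exact: (open_near oV). Qed.

Lemma bracket_agree X X' Y Y' :
  (forall y, V y -> X y = X' y) -> (forall y, V y -> Y y = Y' y) ->
  forall y, V y -> bracket X Y y = bracket X' Y' y.
Proof.
move=> XX YY y Vy; rewrite /bracket (XX y Vy) (YY y Vy).
by rewrite (derive_agree (X' y) YY Vy) (derive_agree (Y' y) XX Vy).
Qed.

Lemma cov_agree X X' Y Y' :
  (forall y, V y -> X y = X' y) -> (forall y, V y -> Y y = Y' y) ->
  forall y, V y -> cov Gamma X Y y = cov Gamma X' Y' y.
Proof.
move=> XX YY y Vy; rewrite /cov (XX y Vy) (YY y Vy).
by rewrite (derive_agree (X' y) YY Vy).
Qed.

Lemma lie_connection_agree Z X X' Y Y' :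
  (forall y, V y -> X y = X' y) -> (forall y, V y -> Y y = Y' y) ->
  forall y, V y ->
  lie_connection Gamma Z X Y y = lie_connection Gamma Z X' Y' y.
Proof.
move=> XX YY y Vy; have ZZ u : V u -> Z u = Z u by [].
rewrite /lie_connection.
exact: (sub2_eq (bracket_agree ZZ (cov_agree XX YY) Vy)
  (cov_agree (bracket_agree ZZ XX) YY Vy) (cov_agree XX (bracket_agree ZZ YY) Vy)).
Qed.

Lemma lie_metric_agree (G : 'rV[R]_n -> 'M[R]_n) Z X X' Y Y' :
  (forall y, V y -> X y = X' y) -> (forall y, V y -> Y y = Y' y) ->
  forall y, V y -> lie_metric G Z X Y y = lie_metric G Z X' Y' y.
Proof.
move=> XX YY y Vy; have ZZ u : V u -> Z u = Z u by [].
have E u : V u -> bilin (G u) (X u) (Y u) = bilin (G u) (X' u) (Y' u).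
  by move=> Vu; exact: (congr2 (bilin (G u)) (XX u Vu) (YY u Vu)).
exact: (sub2_eq (derive_agree (Z y) E Vy)
  (congr2 (bilin (G y)) (bracket_agree ZZ XX Vy) (YY y Vy))
  (congr2 (bilin (G y)) (XX y Vy) (bracket_agree ZZ YY Vy))).
Qed.

Lemma ricci_agree X X' Y Y' :
  (forall y, V y -> X y = X' y) -> (forall y, V y -> Y y = Y' y) ->
  forall y, V y -> ricci Gamma X Y y = ricci Gamma X' Y' y.
Proof.
move=> XX YY y Vy; rewrite /ricci; apply: eq_bigr => k _.
set Z := fun=> _; have ZZ u : V u -> Z u = Z u by [].
apply: (congr1 (fun u : 'rV[R]_n => u 0 k)).
exact: (sub2_eq (cov_agree ZZ (cov_agree XX YY) Vy) (cov_agree XX (cov_agree ZZ YY) Vy)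
  (cov_agree (bracket_agree ZZ XX) YY Vy)).
Qed.
End Locality.

Lemma bilin_delta (R : realType) n (B : 'M[R]_n) a b :
  bilin B (delta_mx 0 a) (delta_mx 0 b) = B a b.
Proof. by rewrite /bilin -rowE trmx_delta -colE !mxE. Qed.

Section Bilin.
Variables (R : realType) (n : nat).
Implicit Types (B : 'M[R]_n) (u v : 'rV[R]_n).

Lemma bilin_delta_l B a v : bilin B (delta_mx 0 a) v = \sum_b B a b * v 0 b.
Proof.
by rewrite /bilin -rowE mxE; apply: eq_bigr => b _; rewrite !mxE.
Qed.

Lemma bilin_delta_r B u b : bilin B u (delta_mx 0 b) = \sum_a u 0 a * B a b.
Proof. by rewrite /bilin trmx_delta -colE !mxE. Qed.

Lemma bilinNl B u v : bilin B (- u) v = - bilin B u v.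
Proof. by rewrite /bilin !mulNmx mxE. Qed.

Lemma bilinNr B u v : bilin B u (- v) = - bilin B u v.
Proof. by rewrite /bilin linearN mulmxN mxE. Qed.
End Bilin.

Lemma outerE (A : pzRingType) p q (u : 'rV[A]_p) (v : 'rV[A]_q) j k :
  (u^T *m v) j k = u 0 j * v 0 k.
Proof. by rewrite mxE big_ord_recl big_ord0 addr0 mxE. Qed.

(** Here [w], [b], [q] stand for |xi|^2 and its first two derivatives along xi,
    [u] for f and [p] for xi(rho); the last two hypotheses are the first- and
    second-order conditions at a maximum of N |xi|^2 + f^2. The first one
    eliminates [b] from the second after multiplication by N. *)
Lemma barrier_ineq (R : realFieldType) (N : nat) (w p q b u : R) :
  0 <= w * p -> 2 * (w * p) <= q ->
  b *+ N + (u * w) *+ 2 = 0 -> q *+ N + (w * w + u * b) *+ 2 <= 0 ->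
  N%:R * w ^+ 2 <= 2 * u ^+ 2 * w.
Proof.
rewrite -[b *+ N]mulr_natl -[q *+ N]mulr_natl -[(u * w) *+ 2]mulr_natl.
rewrite -[(_ + _) *+ 2]mulr_natl; have := ler0n R N; move: N%:R => r r0.
move=> wp0 pq crit conc.
have E : r * b = - (2 * (u * w)) by lra.
have q0 : 0 <= q by lra.
have := ler_wpM2l r0 conc; rewrite mulr0.
have -> : r * (r * q + 2 * (w * w + u * b))
  = r * r * q + 2 * (r * w ^+ 2) + 2 * u * (r * b) by ring.
rewrite E.
have -> : 2 * u * - (2 * (u * w)) = - 2 * (2 * u ^+ 2 * w) by ring.
by have := mulr_ge0 (mulr_ge0 r0 r0) q0; lra.
Qed.

Section Chart.
Variables (R : realType) (n : nat) (M : manifold R n) (i : chart_index M).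

Local Notation U := (cod (atlas i)).
Local Notation oU := (@cod_open R n M (atlas i)).
Local Notation A := (smooth_fun oU).
Local Notation e_ a := (delta_mx 0 a : 'rV[R]_n).
Local Notation ce a := (fun=> delta_mx 0 a : 'rV[R]_n).

(** Finitely many extensions share a neighbourhood, on which an expression in
    several coordinate fields may be evaluated with constant fields. *)
Lemma constant_frame x : U x -> exists (E : 'I_n -> vector_field M) (V : set 'rV[R]_n),
  [/\ open V, V x, V `<=` U & forall a y, V y -> E a i y = e_ a].
Proof.
move=> Ux.
have [E nE] := choice (fun a => extend_const (e_ a) Ux).
have nE' : \forall y \near x, forall a, E a i y = e_ a.
  exact: filter_forall (nbhs_filter x) nE.
have nU : \forall y \near x, U y by apply: open_nbhs_nbhs; split=> //; exact: cod_open.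
exists E, ([set y | U y /\ forall a, E a i y = e_ a]^°); split.
- exact: open_interior.
- exact: filterI nU nE'.
- by move=> y /interior_subset [].
- by move=> a y /interior_subset [_]; apply.
Qed.

Variables (nabla : connection M).

Lemma cov_const (Gamma : 'I_n -> 'rV[R]_n -> 'M[R]_n) a b x :
  cov Gamma (ce a) (ce b) x = \row_k Gamma k x a b.
Proof.
rewrite /cov derive_cst add0r; apply/rowP => k; rewrite !mxE.
exact: bilin_delta.
Qed.

(** nabla_(d_a) d_b has the connection coefficients as components, and covariant
    derivatives of global fields are smooth. *)
Lemma coef_smooth k a b : smooth_on U (fun y => nabla i k y a b).
Proof.
move=> m; apply: class_C_local => x Ux.
have [E [V [oV Vx VU EV]]] := constant_frame Ux; exists V => //.
have [Cs _] := cov_field nabla (E a) (E b).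
apply: (class_C_ext oV) (class_C_sub VU (class_C_entry ord0 k oU (Cs i m))).
move=> y Vy.
by rewrite (cov_agree oV _ (EV a) (EV b) Vy) cov_const mxE.
Qed.

Local Notation d := (fun a => @sder R n U oU a : {additive A -> A}).
(** Connection, metric, field and functions of the chart as tensors over the ring
    of smooth functions. [Gam a] has the entry Gamma_ab^k in row [b], column [k]. *)
Definition Gam (a : 'I_n) : 'M[A]_n := \matrix_(b, k) restr oU (coef_smooth k a b).

Lemma ev_Gam x a b k : U x -> ev x (Gam a b k) = nabla i k x a b.
Proof. by move=> Ux; rewrite mxE /ev restrE. Qed.

Lemma ev_sder_restr x a (h : 'rV[R]_n -> R) (hs : smooth_on U h) : U x ->
  ev x (sder a (restr oU hs)) = 'D_(e_ a) h x.
Proof.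
move=> Ux; rewrite ev_sder //; apply: derive_sf_ext => // y Uy.
exact: restrE.
Qed.

Lemma derive_partialA (h : A) (F : 'rV[R]_n -> R) a x : U x ->
  (forall y, U y -> ev y h = F y) -> 'D_(e_ a) F x = ev x (sder a h).
Proof.
by move=> Ux hF; rewrite ev_sder //; apply/esym; exact: (derive_agree oU _ hF Ux).
Qed.

Variables (g : metric M).
Hypothesis LC : levi_civita g nabla.

Definition gA : 'M[A]_n := restr_mx oU (@gram_smooth R n M g i).

Lemma evm_g x : U x -> evm x gA = g i x.
Proof. exact: evm_restr. Qed.

Lemma ev_g x a b : U x -> ev x (gA a b) = g i x a b.
Proof. by move=> Ux; rewrite -(evm_g Ux) evmE. Qed.

Lemma gA_sym : gA^T = gA.
Proof.
apply: evm_inj => x Ux; apply/matrixP => a b; rewrite !evmE [gA^T a b]mxE.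
by rewrite (ev_g b a Ux) (ev_g a b Ux) -[in LHS](gram_sym g Ux) mxE.
Qed.

Lemma gram_unit x : U x -> \det (g i x) != 0.
Proof.
move=> Ux; apply/det0P => -[v v0 vg]; have := gram_pos g Ux v0.
by rewrite /bilin vg mul0mx mxE ltxx.
Qed.

Lemma ev_det x p (B : 'M[A]_p) : U x -> ev x (\det B) = \det (evm x B).
Proof.
move=> Ux; have mm : monoid_morphism (@ev R n U oU x).
  by split; [exact: ev1|exact: evM].
pose r : {rmorphism A -> R} := HB.pack (@ev R n U oU x)
  (GRing.isMonoidMorphism.Build _ _ _ mm).
exact/esym/(det_map_mx r).
Qed.

Lemma det_inv_smooth : smooth_on U (fun y => (sf_val (\det gA) y)^-1).
Proof.
move=> m; apply: class_C_inv; first exact: cod_open.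
  by move=> x Ux; rewrite -[sf_val _ _]/(ev x _) ev_det // evm_g // gram_unit.
exact: sf_smooth.
Qed.

(** The inverse metric by cofactors, which are polynomials in the entries of the
    metric and hence elements of the ring. *)
Definition giA : 'M[A]_n := restr oU det_inv_smooth *: \adj gA.

Lemma ggiA : gA *m giA = 1%:M.
Proof.
rewrite /giA -scalemxAr mul_mx_adj scale_scalar_mx; congr (_%:M).
apply: ev_inj => x Ux; rewrite evM [RHS]ev1 // [ev x (restr _ _)]restrE //.
rewrite -[sf_val _ _]/(ev x _) mulVf // ev_det // evm_g //; exact: gram_unit.
Qed.

Lemma evm1 x p : U x -> evm x (1%:M : 'M[A]_p) = 1%:M.
Proof.
move=> Ux; apply/matrixP => a b; rewrite !mxE; case: (a == b).
  exact: ev1.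
exact: raddf0.
Qed.

Lemma evm_gi x : U x -> evm x giA = invmx (g i x).
Proof.
move=> Ux; have := congr1 (fun B => evm x B) ggiA; rewrite evmM evm_g // evm1 // => h.
have gu : g i x \in unitmx by rewrite unitmxE unitfE gram_unit.
by rewrite -[LHS]mul1mx -(mulVmx gu) -mulmxA h mulmx1.
Qed.

Lemma Gam_sym a b : row b (Gam a) = row a (Gam b).
Proof.
apply: evm_inj => x Ux; apply/rowP => k.
rewrite !evmE ![row _ _ _ _]mxE !ev_Gam //.
have [E [V [oV Vx VU EV]]] := constant_frame Ux.
have := LC.1 (E a) (E b) i x Ux.
rewrite !(cov_agree oV _ (EV _) (EV _) Vx) (bracket_agree oV (EV _) (EV _) Vx).
rewrite !cov_const /bracket !derive_cst subrr => /eqP.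
by rewrite subr_eq0 => /eqP/rowP/(_ k); rewrite !mxE.
Qed.

Lemma gA_par c : cov_form d Gam c gA = 0.
Proof.
rewrite /cov_form -lock; apply: evm_inj => x Ux; apply/matrixP => a b.
rewrite !evmE !(mx_addE, mx_oppE) dmxE !(evN, evD) ![(_ *m _) a b]mxE !ev_sum.
rewrite [X in _ = ev x X]mxE [RHS]raddf0.
have [E [V [oV Vx VU EV]]] := constant_frame Ux.
have := LC.2 (E c) (E a) (E b) i x Ux.
rewrite !(cov_agree oV _ (EV _) (EV _) Vx) !EV // !cov_const.
rewrite (derive_agree (h := fun y => g i y a b) oV _ _ Vx); last first.
  by move=> y Vy; rewrite !EV // bilin_delta.
rewrite bilin_delta_l bilin_delta_r => h.
have -> : ev x (sder c (gA a b)) = 'D_(e_ c) (fun y => g i y a b) x.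
  by apply/esym/derive_partialA => // y Uy; exact: ev_g.
rewrite h.
have -> : \sum_(k < n) ev x (Gam c a k * gA k b)
    = \sum_k (\row_k nabla i k x c a) 0 k * g i x k b.
  by apply: eq_bigr => k _; rewrite evM ev_Gam // ev_g // mxE.
have -> : \sum_(k < n) ev x (gA a k * (Gam c)^T k b)
    = \sum_k g i x a k * (\row_k nabla i k x c b) 0 k.
  by apply: eq_bigr => k _; rewrite evM ev_g // [(Gam c)^T k b]mxE ev_Gam // mxE.
ring.
Qed.

Variables (xi : vector_field M) (f rho lam : M -> R).
Hypotheses (f_s : smooth_function f) (rho_s : smooth_function rho)
  (lam_s : smooth_function lam).

Definition xiA : 'rV[A]_n := restr_mx oU (proj1 (components_field xi) i).
Definition fA : A := restr oU (f_s i).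
Definition rhoA : A := restr oU (rho_s i).
Definition lamA : A := restr oU (lam_s i).

Lemma ev_xi x k : U x -> ev x (xiA 0 k) = xi i x 0 k.
Proof. by move=> Ux; rewrite -evmE evm_restr. Qed.

Lemma derive_entryA (h : A) (F : 'rV[R]_n -> R) v x : U x ->
  (forall y, U y -> ev y h = F y) ->
  'D_v F x = \sum_c v 0 c * ev x (sder c h).
Proof.
move=> Ux hF; have dh : differentiable h x.
  exact: (smooth_on_diff (@sf_smooth _ _ _ _ h) Ux).
rewrite -(derive_agree (f := h) oU _ hF Ux) derive_rowE //.
by apply: eq_bigr => c _; rewrite ev_sder.
Qed.

Lemma xi_diff x : U x -> differentiable (xi i) x.
Proof. exact: (smooth_on_diff (proj1 (components_field xi) i)). Qed.

Lemma derive_xi v x k : U x ->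
  'D_v (xi i) x 0 k = \sum_c v 0 c * ev x (sder c (xiA 0 k)).
Proof.
move=> Ux; rewrite derive_entry; last exact: xi_diff.
by apply: derive_entryA => // y Uy; exact: ev_xi.
Qed.

Lemma partial_xi a x k : U x -> 'D_(e_ a) (xi i) x 0 k = ev x (sder a (xiA 0 k)).
Proof.
move=> Ux; rewrite derive_entry; last exact: xi_diff.
by apply: derive_partialA => // y Uy; rewrite ev_xi.
Qed.

Hypothesis xi_grad : forall x, U x -> xi i x = grad (g i) (local_rep f i) x.

Lemma ev_differential x (h : M -> R) (hs : smooth_function h) : U x ->
  evm x (differential d (restr oU (hs i))) = \row_l 'D_(e_ l) (local_rep h i) x.
Proof.
move=> Ux; apply/rowP => l; rewrite evmE [LHS](congr1 _ (mxE _ _ _ _)) [RHS]mxE.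
exact: ev_sder_restr.
Qed.

Lemma xi_gradA : differential d fA = xiA *m gA.
Proof.
apply: evm_inj => x Ux; rewrite evmM evm_g // evm_restr // xi_grad //.
rewrite ev_differential // /grad -mulmxA mulVmx ?mulmx1 //.
by rewrite unitmxE unitfE gram_unit.
Qed.

Hypothesis xi_conf : forall (X Y : vector_field M) (x : 'rV[R]_n), U x ->
  lie_connection (nabla i) (xi i) (X i) (Y i) x
    = 'D_(X i x) (local_rep rho i) x *: Y i x
      + 'D_(Y i x) (local_rep rho i) x *: X i x
      - bilin (g i x) (X i x) (Y i x) *: grad (g i) (local_rep rho i) x.

Lemma bracket_const a x : bracket (xi i) (ce a) x = - 'D_(e_ a) (xi i) x.
Proof. by rewrite /bracket derive_cst sub0r. Qed.

Lemma derive_Gam v a b x : U x -> 'D_v (fun y => \row_k nabla i k y a b) x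
  = \row_k \sum_c v 0 c * ev x (sder c (Gam a b k)).
Proof.
move=> Ux; apply/rowP => k; rewrite derive_entry; last first.
  apply: differentiable_mx => j l; rewrite ord1.
  rewrite (_ : (fun y => _) = (fun y => nabla i l y a b)); last first.
    by apply/funext => y; rewrite mxE.
  exact: (smooth_on_diff (coef_smooth _ _ _) Ux).
rewrite [RHS]mxE; apply: derive_entryA => // y Uy.
by rewrite ev_Gam // mxE.
Qed.

Lemma lie_connection_const a b x k : U x ->
  lie_connection (nabla i) (xi i) (ce a) (ce b) x 0 k
    = ev x (lie_Gamma d Gam xiA a b k).
Proof.
move=> Ux; rewrite (lie_GammaE d) /lie_connection.
have -> : cov (nabla i) (ce a) (ce b) = (fun y => \row_k nabla i k y a b).
  by apply/funext => y; exact: cov_const.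
have -> : bracket (xi i) (ce a) = (fun y => - 'D_(e_ a) (xi i) y).
  by apply/funext => y; exact: bracket_const.
have -> : bracket (xi i) (ce b) = (fun y => - 'D_(e_ b) (xi i) y).
  by apply/funext => y; exact: bracket_const.
rewrite /bracket /cov derive_cst add0r derive_Gam //.
have dD : differentiable ('D_(e_ b) (xi i)) x.
  by have [_ /(_ (e_ b)) []] := proj1 (components_field xi) i 2; move=> + _; apply.
rewrite deriveN; last exact: diff_derivable.
rewrite !(mx_addE, mx_oppE) derive_xi // derive_entry // ![(\row__ _) _ _]mxE.
rewrite bilinNl bilinNr bilin_delta_l bilin_delta_r.
rewrite (derive_partialA (h := sder b (xiA 0 k)) a Ux); last first.
  by move=> y Uy; rewrite partial_xi.
rewrite !(evN, evD) !ev_sum.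
have -> : \sum_c ev x (xiA 0 c * sder c (Gam a b k))
    = \sum_c xi i x 0 c * ev x (sder c (Gam a b k)).
  by apply: eq_bigr => c _; rewrite evM ev_xi.
have -> : \sum_e ev x (Gam a b e * sder e (xiA 0 k))
    = \sum_c (\row_k nabla i k x a b) 0 c * ev x (sder c (xiA 0 k)).
  by apply: eq_bigr => c _; rewrite evM ev_Gam // mxE.
have -> : \sum_c ev x (sder a (xiA 0 c) * Gam c b k)
    = \sum_c 'D_(e_ a) (xi i) x 0 c * nabla i k x c b.
  by apply: eq_bigr => c _; rewrite evM ev_Gam // partial_xi.
have -> : \sum_e ev x (sder b (xiA 0 e) * Gam a e k)
    = \sum_c nabla i k x a c * 'D_(e_ b) (xi i) x 0 c.
  by apply: eq_bigr => c _; rewrite evM ev_Gam // partial_xi // mulrC.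
ring.
Qed.

Lemma xi_confA a : lie_Gamma d Gam xiA a = sder a rhoA *: 1%:M
  + (differential d rhoA)^T *m delta_mx 0 a
  - (row a gA)^T *m (differential d rhoA *m giA).
Proof.
apply: evm_inj => x Ux; apply/matrixP => b k.
rewrite !evmE -lie_connection_const //.
have [E [V [oV Vx VU EV]]] := constant_frame Ux.
rewrite -(lie_connection_agree oV _ _ (EV a) (EV b) Vx) xi_conf // !EV //.
rewrite bilin_delta !(mx_addE, mx_oppE, mx_scaleE) !outerE !(evN, evD) !evM.
have D c : 'D_(e_ c) (local_rep rho i) x = ev x (sder c rhoA).
  by rewrite ev_sder_restr.
have -> : ev x ((differential d rhoA *m giA) 0 k)
    = grad (g i) (local_rep rho i) x 0 k.
  by rewrite -evmE evmM evm_gi // ev_differential.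
rewrite !D [differential d rhoA 0 b]mxE [row a gA 0 b]mxE ev_g //.
have ev_delta (p q : nat) (j j' : 'I_p) (l l' : 'I_q) :
    ev x ((delta_mx j l : 'M[A]_(p, q)) j' l') = (delta_mx j l : 'M[R]_(p, q)) j' l'.
  by rewrite !mxE ev_nat.
rewrite ev_delta -[ev x (1%:M b k)]evmE evm1 //; congr (_ * _ + _ - _).
by rewrite !mxE !eqxx /= eq_sym.
Qed.

Lemma curvature_const a b l x k : U x ->
  curvature (nabla i) (ce a) (ce b) (ce l) x 0 k = ev x (Riem d Gam a b l k).
Proof.
move=> Ux; rewrite RiemE /curvature.
have cG b' l' : cov (nabla i) (ce b') (ce l') = (fun y => \row_k nabla i k y b' l').
  by apply/funext => y; exact: cov_const.
have -> : bracket (ce a) (ce b) = (fun=> 0).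
  by apply/funext => y; rewrite /bracket !derive_cst subrr.
rewrite !cG.
have c0 : cov (nabla i) (fun=> 0) (ce l) x = 0.
  rewrite /cov derive0 add0r; apply/rowP => m; rewrite !mxE.
  by rewrite /bilin !mul0mx mxE.
rewrite c0 subr0 /cov !derive_Gam // !(mx_addE, mx_oppE) ![(\row__ _) _ _]mxE.
rewrite !bilin_delta_l !(evN, evD) !ev_sum.
have D b' c : \sum_c0 (delta_mx 0 c : 'rV[R]_n) 0 c0 * ev x (sder c0 (Gam b' l k))
    = ev x (sder c (Gam b' l k)).
  rewrite (bigD1 c) //= big1 ?addr0 => [|e /negPf ec]; first by rewrite mxE !eqxx mul1r.
  by rewrite mxE ec andbF mul0r.
rewrite !D.
have E b' c : \sum_b0 nabla i k x c b0 * (\row_k0 nabla i k0 x b' l) 0 b0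
    = \sum_e ev x (Gam b' l e * Gam c e k).
  by apply: eq_bigr => e _; rewrite evM !ev_Gam // mxE mulrC.
rewrite !E; ring.
Qed.

Lemma ricci_const b l x : U x ->
  ricci (nabla i) (ce b) (ce l) x = ev x (Ric d Gam b l).
Proof.
move=> Ux; rewrite /ricci [Ric _ _ b l]mxE ev_sum; apply: eq_bigr => a _.
exact: curvature_const.
Qed.

Lemma lie_metric_const a b x : U x ->
  lie_metric (g i) (xi i) (ce a) (ce b) x = ev x (lie_form d gA xiA a b).
Proof.
move=> Ux; rewrite lie_formE /lie_metric.
have -> : (fun y => bilin (g i y) (e_ a) (e_ b)) = (fun y => g i y a b).
  by apply/funext => y; rewrite bilin_delta.
rewrite !bracket_const bilinNl bilinNr bilin_delta_l bilin_delta_r !opprK.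
rewrite !evD !ev_sum (derive_entryA (h := gA a b) (xi i x) Ux); last first.
  by move=> y Uy; rewrite ev_g.
congr (_ + _ + _).
- by apply: eq_bigr => c _; rewrite evM ev_xi.
- by apply: eq_bigr => c _; rewrite evM ev_g // partial_xi.
- apply: eq_bigr => c _; rewrite evM ev_g // partial_xi // mulrC.
  by have /matrixP/(_ a c) := gram_sym g Ux; rewrite mxE => ->.
Qed.

Hypothesis soliton : forall (X Y : vector_field M) (x : 'rV[R]_n), U x ->
  2^-1 * lie_metric (g i) (xi i) (X i) (Y i) x + ricci (nabla i) (X i) (Y i) x
  = local_rep lam i x * bilin (g i x) (X i x) (Y i x).

Lemma solitonA : lie_form d gA xiA + Ric d Gam + Ric d Gam = (lamA + lamA) *: gA.
Proof.
apply: evm_inj => x Ux; apply/matrixP => a b.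
rewrite !evmE mx_scaleE (mx_addE (_ + _)) (mx_addE (lie_form _ _ _)).
rewrite !evD evM evD ev_g // -lie_metric_const // -ricci_const //.
have [E [V [oV Vx VU EV]]] := constant_frame Ux.
have := soliton (E a) (E b) Ux.
rewrite (lie_metric_agree oV _ _ (EV a) (EV b) Vx).
rewrite (ricci_agree oV _ (EV a) (EV b) Vx) !EV // bilin_delta.
have -> : ev x lamA = local_rep lam i x by exact: restrE.
set L := lie_metric _ _ _ _ _; set C := ricci _ _ _ _ => h.
by rewrite -addrA mulrDl -h; field.
Qed.

Local Notation W := (fun y => bilin (g i y) (xi i y) (xi i y)).
Local Notation wA := (sqnorm gA xiA).

Lemma ev_form x (B : 'M[A]_n) (u v : 'rV[A]_n) :
  ev x ((u *m B *m v^T) 0 0) = bilin (evm x B) (evm x u) (evm x v).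
Proof. by rewrite -evmE !evmM /bilin /evm map_trmx. Qed.

Lemma ev_sqnorm x : U x -> ev x wA = W x.
Proof. by move=> Ux; rewrite ev_form evm_g // evm_restr. Qed.

Lemma ev_along (h : A) (F : 'rV[R]_n -> R) x : U x ->
  (forall y, U y -> ev y h = F y) -> 'D_(xi i x) F x = ev x (along d xiA h).
Proof.
move=> Ux hF; rewrite (derive_entryA _ Ux hF) ev_sum.
by apply: eq_bigr => c _; rewrite evM ev_xi.
Qed.

Lemma ev_f x : U x -> ev x fA = local_rep f i x.
Proof. exact: restrE. Qed.
Lemma ev_rho x : U x -> ev x rhoA = local_rep rho i x.
Proof. exact: restrE. Qed.
Lemma ev_lam x : U x -> ev x lamA = local_rep lam i x.
Proof. exact: restrE. Qed.

Let dM := @sderM R n U oU.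
Let dC := @sderC R n U oU.
Let tf := @sf_torsion_free R n U oU.

Lemma bilin_ge0 x u : U x -> 0 <= bilin (g i x) u u.
Proof.
move=> Ux; have [->|u0] := eqVneq u 0; first by rewrite /bilin !mul0mx mxE.
exact/ltW/gram_pos.
Qed.

(** The discarded term is 4 |nabla_xi xi|^2. *)
Lemma along_along_sqnorm_ge x : U x ->
  2 * (W x * 'D_(xi i x) (local_rep rho i) x)
    <= ev x (along d xiA (along d xiA wA)).
Proof.
move=> Ux.
rewrite (along_along_sqnorm dM dC tf Gam_sym gA_sym ggiA gA_par xi_gradA xi_confA).
rewrite evD !evMn evM ev_sqnorm // -(ev_along Ux ev_rho) mulr_natl.
by rewrite lerDl mulrn_wge0 // ev_form evm_g // bilin_ge0.
Qed.

Hypothesis n_gt2 : (2 < n)%N.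

Lemma derive_lam_rho x v : U x ->
  'D_v (local_rep lam i) x = 'D_v (local_rep rho i) x.
Proof.
move=> Ux; rewrite (derive_entryA v Ux ev_lam) (derive_entryA v Ux ev_rho).
apply: eq_bigr => c _; congr (_ * _).
have := congr1 (ev x) (differential_lam_rho dM dC tf Gam_sym gA_sym ggiA gA_par xi_gradA
  xi_confA solitonA c).
rewrite evM !evB !ev_nat // [RHS]raddf0 => /eqP; rewrite mulf_eq0.
by rewrite subr_eq0 eqr_nat gtn_eqF //= subr_eq0 => /eqP.
Qed.

(** The soliton equation at X = Y = xi, where L_xi g(xi, xi) is xi|xi|^2,
    expresses Ric(xi, xi) by quantities that the tensor calculus has evaluated. *)
Lemma ricci_xi x : U x -> ricci (nabla i) (xi i) (xi i) x
  = (1 - n%:R) * 'D_(xi i x) (local_rep rho i) x.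
Proof.
move=> Ux; have := congr1 (ev x) (Ric_xi_xi dM dC tf Gam_sym gA_sym ggiA gA_par
  xi_gradA xi_confA solitonA).
rewrite [ev x (_ * along _ _ _)]evM !evB evM ev_nat // ev1 //.
rewrite -(ev_along Ux ev_rho) => <-.
rewrite ev_lam // ev_sqnorm // -(soliton xi xi Ux) /lie_metric.
have -> : bracket (xi i) (xi i) x = 0 by rewrite /bracket subrr.
rewrite /bilin linear0 mulmx0 !mul0mx mxE !subr0 -/(bilin _ _ _).
have := ev_along Ux ev_sqnorm.
rewrite (along_sqnorm dM Gam_sym gA_sym gA_par) evMn => ->.
by rewrite mulr2n; field.
Qed.

Lemma derive_rho0 x v : U x -> xi i x = 0 -> 'D_v (local_rep rho i) x = 0.
Proof.
move=> Ux xi0; rewrite (derive_entryA v Ux ev_rho) big1 // => c _.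
have := congr1 (fun u => evm x u) (xi_differential_rho dM dC tf Gam_sym gA_sym
  ggiA gA_par xi_gradA xi_confA solitonA).
rewrite evmM evm_restr // xi0 mul0mx => /rowP/(_ c).
rewrite evmE mx_scaleE [differential _ _ 0 c]mxE evM evB ev1 // ev_nat //.
rewrite [LHS]mxE => /esym/eqP; rewrite mulf_eq0 subr_eq0 eq_sym.
rewrite -[1]/(1%:R) eqr_nat gtn_eqF ?(ltn_trans _ n_gt2) //= => /eqP ->.
by rewrite mulr0.
Qed.

(** Both derivative tests are evaluated in the ring, where [along_barrier] and
    [along_along_barrier] apply. *)
Lemma barrier_critical_bound (N : nat) x : U x ->
  0 <= 'D_(xi i x) (local_rep rho i) x -> 
  'D_(xi i x) (sf_val (wA *+ N + fA * fA)) x = 0 ->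
  'D_(xi i x) (fun y => 'D_(xi i y) (sf_val (wA *+ N + fA * fA)) y) x <= 0 ->
  N%:R * W x ^+ 2 <= 2 * local_rep f i x ^+ 2 * W x.
Proof.
move=> Ux rho0 crit conc; set h := _ + _ in crit conc.
have evh : forall y, U y -> ev y h = sf_val h y by [].
have D1 : forall y, U y -> ev y (along d xiA h) = 'D_(xi i y) (sf_val h) y.
  by move=> y Uy; rewrite (ev_along Uy evh).
move: conc; rewrite (ev_along Ux D1); move: crit; rewrite (ev_along Ux evh).
rewrite /h (along_along_barrier dM xi_gradA) (along_barrier dM xi_gradA).
rewrite !(evD, evMn) !evM ev_f // ev_sqnorm //.
exact: (barrier_ineq (mulr_ge0 (bilin_ge0 (xi i x) Ux) rho0)
  (along_along_sqnorm_ge Ux)).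
Qed.
End Chart.

(** * Maxima of functions on open subsets of R^n *)

Lemma second_diff_le (R : realFieldType) (a b m c t r : R) :
  a <= m -> b <= m -> `|(m - a - b + m) / t ^+ 2 + c| <= r -> c <= r.
Proof.
move=> am bm; rewrite ler_norml => /andP[_].
have : 0 <= (m - a - b + m) / t ^+ 2 by rewrite divr_ge0 ?sqr_ge0 //; lra.
lra.
Qed.

Section LocalMaximum.
Variables (R : realType) (n : nat) (U : set 'rV[R]_n) (h : 'rV[R]_n -> R).
Variable x : 'rV[R]_n.
Hypotheses (oU : open U) (Ux : U x) (h2 : class_C 2 U h).
Hypothesis h_max : forall y, U y -> h y <= h x.

Lemma near_line (v : 'rV[R]_n) : exists2 e : R, 0 < e &
  forall t : R, `|t| < e -> U (t *: v + x).
Proof.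
have /nbhs_normP[d /= d0 dU] : nbhs x U by apply: open_nbhs_nbhs.
exists (d / (`|v| + 1)); first by rewrite divr_gt0 // ltr_wpDl.
move=> t; rewrite ltr_pdivlMr ?ltr_wpDl // => td; apply: dU.
rewrite /ball_ /= opprD addrCA subrr addr0 normrN normrZ.
by apply: le_lt_trans td; rewrite ler_wpM2l // lerDl.
Qed.

Lemma derive_at_max v : 'D_v h x = 0.
Proof.
have [e e0 eU] := near_line v.
pose phi t := h (t *: v + x).
have dh y : U y -> differentiable h y by case: h2 => + _; exact.
have tU t : t \in `](- e), e[ -> U (t *: v + x).
  by rewrite in_itv /= -ltr_norml => /eU.
have phi_max t : t \in `](- e), e[ -> phi t <= phi 0.
  by move=> /tU /h_max; rewrite /phi scale0r add0r.
have dphi t : t \in `](- e), e[ -> derivable phi t 1.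
  move=> /tU /dh dt; exact: (@ex_derive _ _ _ _ _ _ _ (is_derive_line dt)).
have z : 0 \in `](- e), e[ by rewrite in_itv /= oppr_lt0 e0.
have e' : - e <= e by rewrite ge0_cp ?ltW.
have d0 := derive1_at_max e' dphi z phi_max.
have dx : differentiable h (0 *: v + x) by rewrite scale0r add0r; exact: dh.
have := @derive_val _ _ _ _ _ _ _ (is_derive_line dx).
by rewrite (@derive_val _ _ _ _ _ _ _ d0) scale0r add0r => ->.
Qed.

(** The second difference in the directions v and - v is
    2 h(x) - h(x + t v) - h(x - t v), nonnegative at a maximum. *)
Lemma derive2_at_max v : 'D_v ('D_v h) x <= 0.
Proof.
have [e e0 eU] := near_line v.
case: h2 => dh /(_ v) [dd _].
have ndh : \forall y \near x, differentiable h y by exact: (open_near oU).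
apply/ler_addgt0Pr => r r0; rewrite add0r.
have [d d0 dP] := second_diff_approx (- v) r0 ndh (dd x Ux).
pose t := Num.min e d / 2.
have m0 : 0 < Num.min e d by rewrite lt_min e0.
have t0 : 0 < t by rewrite divr_gt0.
have [te td] : t < e /\ t < d by apply/andP; rewrite -lt_min /t; lra.
have E : 'D_(- v) ('D_v h) x = - 'D_v ('D_v h) x.
  by rewrite !deriveE ?linearN //; exact: dd.
have h1 : h (t *: v + x) <= h x by apply/h_max/eU; rewrite gtr0_norm.
have h2' : h (t *: - v + x) <= h x.
  by apply: h_max; rewrite scalerN -scaleNr; apply: eU; rewrite normrN gtr0_norm.
have := dP t t0 td; rewrite E /second_diff.
have -> : t *: v + (t *: - v + x) = x by rewrite scalerN addNKr.
rewrite opprK; exact: second_diff_le.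
Qed.

(** At a critical point the derivative of [X] does not contribute. *)
Lemma derive_along_at_max (X : 'rV[R]_n -> 'rV[R]_n) : differentiable X x ->
  'D_(X x) (fun y => 'D_(X y) h y) x <= 0.
Proof.
move=> dX; apply: le_trans (derive2_at_max (X x)).
case: (h2) => dh dd; have dda a : differentiable ('D_(delta_mx 0 a) h) x.
  by case: (dd (delta_mx 0 a)) => + _; exact.
have dXa a : differentiable (fun y => X y 0 a) x by exact: differentiable_entry.
have sumE (Y : 'rV[R]_n -> 'rV[R]_n) : differentiable Y x ->
    'D_(X x) (fun y => 'D_(Y y) h y) x
      = \sum_a Y x 0 a * 'D_(X x) ('D_(delta_mx 0 a) h) x.
  move=> dY; have dYa a : differentiable (fun y => Y y 0 a) x.
    exact: differentiable_entry.
  have -> : 'D_(X x) (fun y => 'D_(Y y) h y) x = 'D_(X x)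
      (\sum_a ((fun y => Y y 0 a) * 'D_(delta_mx 0 a) h)) x.
    apply: near_eq_derive; apply: (open_near oU Ux) => y Uy.
    by rewrite derive_rowE ?fct_sumE //; exact: dh.
  rewrite derive_sum; last first.
    by move=> a; apply: derivableM; apply: diff_derivable.
  apply: eq_bigr => a _; rewrite deriveM; [|exact: diff_derivable..].
  by rewrite derive_at_max scale0r addr0.
by rewrite (sumE X dX) (sumE (cst (X x)) (differentiable_cst _ _)).
Qed.
End LocalMaximum.

(** * From charts to the manifold *)

(** [m] and [u0] are the values of |xi|^2 and f at a point where xi does not
    vanish, [w] and [u] their values at a maximum of N |xi|^2 + f^2; the last
    hypothesis is [barrier_critical_bound]. *)
Lemma barrier_max_absurd (R : realFieldType) (N : nat) (m w u C u0 : R) :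
  0 <= w -> 3 * C < N%:R * m -> u ^+ 2 <= C ->
  N%:R * m + u0 ^+ 2 <= N%:R * w + u ^+ 2 ->
  N%:R * w ^+ 2 <= 2 * u ^+ 2 * w -> False.
Proof.
move=> w0 Cm uC mx h.
have := sqr_ge0 u; have := sqr_ge0 u0 => u00 uu0.
have Nw : 2 * u ^+ 2 < N%:R * w by lra.
have wp : 0 < w.
  rewrite lt_neqAle w0 andbT eq_sym; apply/eqP => wz.
  by move: Nw; rewrite wz mulr0; lra.
have : 2 * u ^+ 2 * w < N%:R * w * w by rewrite ltr_pM2r.
by move: h; rewrite expr2 mulrA; lra.
Qed.

Section Vanishing.
Variables (R : realType) (n : nat) (M : manifold R n) (i : chart_index M).
Local Notation U := (cod (atlas i)).
Local Notation oU := (@cod_open R n M (atlas i)).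
Variables (xi : vector_field M).
Hypothesis xi0 : forall x, U x -> xi i x = 0.

Lemma bracket_vanish (Y : 'rV[R]_n -> 'rV[R]_n) x : U x -> bracket (xi i) Y x = 0.
Proof.
move=> Ux; rewrite /bracket xi0 // derive0 sub0r.
rewrite (derive_agree (h := cst 0) oU _ xi0 Ux).
by rewrite derive_cst oppr0.
Qed.

Lemma lie_connection_vanish Gamma (X Y : 'rV[R]_n -> 'rV[R]_n) x : U x ->
  lie_connection Gamma (xi i) X Y x = 0.
Proof.
move=> Ux; rewrite /lie_connection bracket_vanish //.
have bX := bracket_vanish X; have bY := bracket_vanish Y.
have E1 := cov_agree oU Gamma (X' := cst 0) (Y' := Y) bX (fun y _ => erefl) Ux.
have E2 := cov_agree oU Gamma (X' := X) (Y' := cst 0) (fun y _ => erefl) bY Ux.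
rewrite E1 E2 sub0r.
have -> : cov Gamma (cst 0) Y x = 0.
  rewrite /cov derive0 add0r; apply/rowP => k.
  by rewrite !mxE /bilin !mul0mx mxE.
have -> : cov Gamma X (cst 0) x = 0.
  rewrite /cov derive_cst add0r; apply/rowP => k.
  by rewrite !mxE /bilin linear0 mulmx0 mxE.
by rewrite oppr0 addr0.
Qed.

Lemma lie_metric_vanish G (X Y : 'rV[R]_n -> 'rV[R]_n) x : U x ->
  lie_metric G (xi i) X Y x = 0.
Proof.
move=> Ux; rewrite /lie_metric !bracket_vanish // xi0 // derive0.
by rewrite /bilin linear0 mulmx0 !mul0mx !mxE !subr0.
Qed.
End Vanishing.

(** Mean value theorem on the segment from [x] to [y], inside a ball. *)
Lemma derive0_locally_constant (R : realType) (n : nat) (U : set 'rV[R]_n)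
    (h : 'rV[R]_n -> R) x : open U -> U x ->
  (forall y, U y -> differentiable h y) ->
  (forall y v, U y -> 'D_v h y = 0) -> \forall y \near x, h y = h x.
Proof.
move=> oU Ux dh h0.
have /nbhs_normP[e /= e0 eU] : nbhs x U by apply: open_nbhs_nbhs.
apply/nbhs_normP; exists e => //= y; rewrite /ball_ /= => ye.
pose phi (t : R) := h (t *: (y - x) + x).
have tU (t : R) : t \in `[0, 1]%R -> U (t *: (y - x) + x).
  rewrite in_itv /= => /andP[t0 t1]; apply: eU; rewrite /ball_ /=.
  rewrite opprD addrCA subrr addr0 normrN normrZ ger0_norm //.
  rewrite distrC; apply: le_lt_trans ye.
  by rewrite ler_piMl.
have dphi (t : R) : t \in `[0, 1]%R -> is_derive t 1 phi 0.
  move=> t01; have Ut := tU t t01.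
  by have := is_derive_line (dh _ Ut); rewrite h0.
have cphi : {within `[0, 1], continuous phi}.
  apply: derivable_within_continuous => t t01.
  exact: (@ex_derive _ _ _ _ _ _ _ (dphi t t01)).
have dphi' (t : R) : t \in `]0, 1[%R -> is_derive t 1 phi 0.
  by rewrite in_itv /= => /andP[/ltW t0 /ltW t1]; apply: dphi; rewrite in_itv /= t0.
have [c _] := MVT ltr01 dphi' cphi; rewrite mul0r => /eqP.
by rewrite subr_eq0 /phi scale1r scale0r add0r subrK => /eqP.
Qed.

Section Global.
Variables (R : realType) (n : nat) (M : manifold R n).

Lemma manifold_ind (P : M -> Prop) :
  (forall i x, cod (atlas i) x -> P (param (atlas i) x)) -> forall p, P p.
Proof.
move=> H p; have [i di] := atlas_cover p.
by rewrite -(coordsK di); apply: H; exact: coords_cod.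
Qed.

Lemma continuous_of_charts (h : M -> R) (H : chart_index M -> 'rV[R]_n -> R) :
  (forall i x, cod (atlas i) x -> h (param (atlas i) x) = H i x) ->
  (forall i x, cod (atlas i) x -> {for x, continuous (H i)}) -> continuous h.
Proof.
move=> hH Hc p; have [i di] := atlas_cover p.
have E : {near p, H i \o coords (atlas i) =1 h}.
  have : nbhs p (dom (atlas i)).
    by apply: open_nbhs_nbhs; split=> //; exact: dom_open.
  apply: filterS => q dq /=.
  by rewrite -hH ?coordsK //; exact: coords_cod.
apply: near_eq_continuous E _; apply: continuous_comp.
  exact: coords_continuous.
by apply: Hc; exact: coords_cod.
Qed.

Lemma locally_constant_constant (h : M -> R) : connected [set: M] ->
  (forall p, \forall q \near p, h q = h p) -> exists a, forall p, h p = a.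
Proof.
move=> cM hl; have [[p0 _]|ne] := pselect (exists p : M, True); last first.
  by exists 0 => p; exfalso; apply: ne; exists p.
exists (h p0); pose B := [set p | h p = h p0].
have oB : open B.
  by rewrite openE => p Bp; apply: filterS (hl p) => q hq; rewrite /B /= hq.
have cB : closed B.
  rewrite -[B]setCK; apply: open_closedC; rewrite openE => p Bp.
  by apply: filterS (hl p) => q hq; rewrite /B /= hq.
have : B = [set: M].
  apply: cM; first by exists p0.
  - by exists B => //; rewrite setTI.
  - by exists B => //; rewrite setTI.
by move=> BT p; have : B p by rewrite BT.
Qed.

Variables (g : metric M) (xi : vector_field M).

(** The local expressions of |xi|^2 glue: choose a chart at every point and
    compare by the change-of-chart laws of [g] and [xi]. *)
Lemma sqnorm_global : exists w : M -> R, forall i x, cod (atlas i) x ->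
  w (param (atlas i) x) = bilin (g i x) (xi i x) (xi i x).
Proof.
have [k kP] := choice (@atlas_cover R n M).
exists (fun p => let x := coords (atlas (k p)) p in
  bilin (g (k p) x) (xi (k p) x) (xi (k p) x)) => i x Ux /=.
set p := param (atlas i) x.
have ov : overlap (atlas i) (atlas (k p)) x by split=> //; exact: kP.
rewrite (gram_transition g _ _ ov).
by have [_ /(_ _ _ _ ov) <-] := components_field xi.
Qed.
End Global.

Theorem proposition4p4 (R : realType) (n : nat) (n_gt2 : (2 < n)%N)
    (M : manifold R n) (g : metric M) (nabla : connection M)
    (xi : vector_field M) (lambda : M -> R) :
  compact [set: carrier M] -> connected [set: carrier M] ->
  levi_civita g nabla ->
  almost_ricci_soliton g nabla xi lambda ->
  gradient_field g xi ->
  affine_conformal_killing g nabla xi ->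
  (forall (i : chart_index M) (x : 'rV[R]_n), cod (atlas i) x ->
    - (n%:R * 'D_(xi i x) (local_rep lambda i) x)
      <= ricci (nabla i) (xi i) (xi i) x) ->
  affine_killing nabla xi /\ trivial_ricci_soliton g nabla xi lambda.
Proof.
move=> cptM connM LC sol [f f_s xi_grad] [rho rho_s xi_conf] ric_ge.
have [lam_s soliton] := sol.
have xi_conf' i (X Y : vector_field M) x := xi_conf X Y i x.
have soliton' i (X Y : vector_field M) x := soliton X Y i x.
have lam_rho i x v (Ux : cod (atlas i) x) := derive_lam_rho LC f_s rho_s lam_s
  (xi_grad i) (xi_conf' i) (soliton' i) n_gt2 v Ux.
have rho0 i x v (Ux : cod (atlas i) x) := derive_rho0 LC f_s rho_s lam_s
  (xi_grad i) (xi_conf' i) (soliton' i) n_gt2 v Ux.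
have rho_ge0 i x : cod (atlas i) x -> 0 <= 'D_(xi i x) (local_rep rho i) x.
  move=> Ux; have := ric_ge i x Ux.
  rewrite (ricci_xi LC f_s rho_s lam_s (xi_grad i) (xi_conf' i) (soliton' i) Ux).
  by rewrite lam_rho //; lra.
have [w wE] := sqnorm_global g xi.
have f_c : continuous f.
  apply: (@continuous_of_charts _ _ _ _ (fun i => local_rep f i)) => // i x Ux.
  exact: class_C_continuous (f_s i 0) Ux.
have w_ge0 : forall p, 0 <= w p.
  by apply: manifold_ind => i x Ux; rewrite wE // bilin_ge0.
have xi0 i x : cod (atlas i) x -> xi i x = 0.
  move=> Ux; apply/eqP; apply: contrapT => /negP xi_n0.
  pose p0 := param (atlas i) x; pose m := w p0.
  have m0 : 0 < m by rewrite /m wE //; exact: gram_pos.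
  have M0 : [set: M] !=set0 by exists p0.
  have [c _ c_max] := compact_EVT_max (f := fun p => f p * f p) M0 cptM
    (continuous_subspaceT (fun p => continuousM (f_c p) (f_c p))).
  pose C := f c ^+ 2.
  have fC p : f p ^+ 2 <= C by rewrite !expr2; apply: c_max; rewrite inE.
  (* with this N the term N w exceeds 2 f^2 at every maximum of F *)
  pose N := Num.bound (3 * C / m).
  have NC : 3 * C < N%:R * m.
    rewrite -ltr_pdivrMr //; apply: archi_boundP.
    by rewrite divr_ge0 ?(ltW m0) // mulr_ge0 // sqr_ge0.
  pose F p := N%:R * w p + f p ^+ 2.
  pose h j := sqnorm (gA j g) (xiA j xi) *+ N + fA j f_s * fA j f_s.
  have FE j y : cod (atlas j) y -> F (param (atlas j) y) = sf_val (h j) y.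
    move=> Uy; rewrite -[RHS]/(ev y (h j)) evD evMn evM ev_sqnorm // ev_f //.
    by rewrite /F wE // expr2 mulr_natl.
  have F_c : continuous F.
    apply: (continuous_of_charts FE) => j y Uy.
    exact: class_C_continuous (@sf_smooth _ _ _ _ (h j) 0) Uy.
  have [q _ q_max] := compact_EVT_max M0 cptM (continuous_subspaceT F_c).
  have [j qj] := atlas_cover q.
  pose y := coords (atlas j) q.
  have Uy : cod (atlas j) y by exact: coords_cod.
  have yq : param (atlas j) y = q by exact: coordsK.
  have h_max z : cod (atlas j) z -> h j z <= h j y.
    by move=> Uz; rewrite -!FE // yq; apply: q_max; rewrite inE.
  have h2 := @sf_smooth _ _ _ _ (h j) 2.
  have crit := derive_at_max (@cod_open _ _ _ _) Uy h2 h_max (xi j y).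
  have conc := derive_along_at_max (@cod_open _ _ _ _) Uy h2 h_max (xi_diff xi Uy).
  have := barrier_critical_bound LC rho_s (xi_grad j) (xi_conf' j) Uy
    (rho_ge0 j y Uy) crit conc.
  rewrite -wE // /local_rep /= yq => bad.
  have Fq : F p0 <= F q by apply: q_max; rewrite inE.
  exact: barrier_max_absurd (w_ge0 q) NC (fC q) Fq bad.
split; [|split; [split=> //|]].
- by move=> X Y i x Ux; apply: lie_connection_vanish => // y; exact: xi0.
- apply: locally_constant_constant connM _; apply: manifold_ind => i x Ux.
  have lam_d y : cod (atlas i) y -> differentiable (local_rep lambda i) y.
    exact: smooth_on_diff (lam_s i).
  have lam0 y v : cod (atlas i) y -> 'D_v (local_rep lambda i) y = 0.
    by move=> Uy; rewrite lam_rho // rho0 // xi0.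
  have lam_const := derive0_locally_constant (@cod_open _ _ _ _) Ux lam_d lam0.
  have dp : dom (atlas i) (param (atlas i) x) by exact: param_dom.
  have nd : \forall q \near param (atlas i) x, dom (atlas i) q.
    by apply: open_nbhs_nbhs; split=> //; exact: dom_open.
  have nx : nbhs (coords (atlas i) (param (atlas i) x))
      [set y | local_rep lambda i y = local_rep lambda i x] by rewrite paramK.
  have nc := coords_continuous dp nx.
  apply: filterS2 nd nc => q dq; rewrite /local_rep /= coordsK //.
- by move=> X Y i x Ux; apply: lie_metric_vanish => // y; exact: xi0.
Qed.
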